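(* Let $K=2$, let the node potential be deterministic, $h(x)=\exp(-x^2)$ for $x\in\mathbb{R}$, and let the edge potential be deterministic, given by $$J(x,y)=1-\sum_{r\ge1}\gamma_r\mathbf{1}\{x,y\in A_r\},\qquad x,y\in\mathbb{R},$$ where $A_r$, $r\ge1$, is any countably infinite collection of mutually disjoint measurable subsets of $\mathbb{R}$ and $\gamma_r\in\{0,1\}$ for all $r$. Suppose there exist $r_0\ge1$ and $\kappa>0$ such that $\gamma_{r_0}=0$ and $[0,\kappa)\subset A_{r_0}$. Then for every $c>0$ the random graph sequence $\mathbb{G}(N,c)$, $N\ge1$, is right-converging with respect to these potentials.
   Context: For $c>0$ (and $K=2$), $\mathbb{G}(N,c)$ is the random directed multigraph on nodes $\{1,\dots,N\}$ with $\lfloor cN\rfloor$ edges, each an ordered pair $e=(u^e_1,u^e_2)$ chosen independently and uniformly at random from $\{1,\dots,N\}^2$ (loops and repetitions allowed). The partition function is $$Z(\mathbb{G}(N,c))=\int_{\mathbb{R}^N}\prod_{1\le u\le N}h(x_u)\prod_{e}J(x_{u^e_1},x_{u^e_2})\,dx,$$ the second product being over all edges, with $\log 0=-\infty$. The sequence is right-converging (with respect to $h,J$) if there is a deterministic real $z$ such that for every $\epsilon>0$, $\lim_{N\to\infty}\mathbb{P}\bigl(|N^{-1}\log Z(\mathbb{G}(N,c))-z|>\epsilon\bigr)=0$. *)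

(* Defs.v *)
From HB Require Import structures.
From mathcomp Require Import all_boot all_order all_algebra.
From mathcomp Require Import all_classical all_reals all_analysis.

Set Implicit Arguments.
Unset Strict Implicit.
Unset Printing Implicit Defensive.

Import Order.TTheory GRing.Theory Num.Theory.
Import numFieldNormedType.Exports.

Local Open Scope classical_set_scope.
Local Open Scope ring_scope.

Section tuple_measure.
Context {d : measure_display} {T : measurableType d} {R : realType}.

Definition tcons (n : nat) (p : T * n.-tuple T) : n.+1.-tuple T :=
  [tuple of p.1 :: p.2].

Lemma measurable_tcons (n : nat) : measurable_fun [set: (T * n.-tuple T)%type] (@tcons n).
Proof. exact: measurable_cons. Qed.

Definition tuncons (n : nat) (t : n.+1.-tuple T) : T * n.-tuple T :=
  (thead t, [tuple of behead t]).

Lemma tconsK (n : nat) : cancel (@tcons n) (@tuncons n).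
Proof. by move=> [x t]; congr pair; apply/val_inj. Qed.

Lemma measurable_tuncons (n : nat) :
  measurable_fun [set: n.+1.-tuple T] (@tuncons n).
Proof.
apply/measurable_fun_pairP; split; last exact: measurable_behead.
exact: (measurable_tnth ord0).
Qed.

Section tcons_measure.
Variables (mu : {sigma_finite_measure set T -> \bar R}) (n : nat).
Variable nu : {sigma_finite_measure set (n.-tuple T) -> \bar R}.

Definition tcons_measure : set (n.+1.-tuple T) -> \bar R :=
  pushforward (mu \x nu)%E (@tcons n).

Let tcons_measure0 : tcons_measure set0 = 0%E.
Proof. by rewrite /tcons_measure /pushforward preimage_set0 measure0. Qed.

Let tcons_measure_ge0 A : (0 <= tcons_measure A)%E.
Proof. by rewrite /tcons_measure /pushforward; apply: measure_ge0. Qed.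

Let tcons_measure_sigma_additive : semi_sigma_additive tcons_measure.
Proof.
move=> F mF tF mUF; rewrite /tcons_measure /pushforward preimage_bigcup.
apply: measure_semi_sigma_additive.
- by move=> i; rewrite -[X in measurable X]setTI; exact: measurable_tcons.
- apply/trivIsetP => /= i j _ _ ij; rewrite -preimage_setI.
  by move/trivIsetP : tF => /(_ _ _ _ _ ij) ->//; rewrite preimage_set0.
- by rewrite -preimage_bigcup -[X in measurable X]setTI; exact: measurable_tcons.
Qed.

HB.instance Definition _ := isMeasure.Build _ _ _ tcons_measure
  tcons_measure0 tcons_measure_ge0 tcons_measure_sigma_additive.

Let tcons_measure_sigma_finite : sigma_finite setT tcons_measure.
Proof.
have /sigma_finiteP[F [FT ndF Foo]] := sigma_finiteT mu.
have /sigma_finiteP[G [GT ndG Goo]] := sigma_finiteT nu.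
exists (fun i => @tuncons n @^-1` (F i `*` G i)).
  rewrite -preimage_bigcup (_ : \bigcup_i _ = setT) ?preimage_setT//.
  rewrite -subTset => -[x t] _.
  have [i _ Fx] : (\bigcup_i F i) x by rewrite -FT.
  have [j _ Gt] : (\bigcup_i G i) t by rewrite -GT.
  exists (maxn i j) => //; split.
    by move: x Fx; exact/subsetPset/ndF/leq_maxl.
  by move: t Gt; exact/subsetPset/ndG/leq_maxr.
move=> i; have [mF muF] := Foo i; have [mG muG] := Goo i; split.
  rewrite -[X in measurable X]setTI; apply: measurable_tuncons => //.
  exact: measurableX.
rewrite /tcons_measure /pushforward -comp_preimage.
rewrite (_ : _ \o _ = id) ?preimage_id; last exact/funext/tconsK.
by rewrite product_measure1E// lte_mul_pinfty// ge0_fin_numE.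
Qed.

HB.instance Definition _ := @Measure_isSigmaFinite.Build _ _ _ tcons_measure
  tcons_measure_sigma_finite.

End tcons_measure.

(* The n-fold product measure mu^n; tuple_measure_box characterizes it.       *)
Fixpoint tuple_measure (mu : {sigma_finite_measure set T -> \bar R}) (n : nat) :
    {sigma_finite_measure set (n.-tuple T) -> \bar R} :=
  match n with
  | 0 => [the {sigma_finite_measure set (0.-tuple T) -> \bar R}
            of \d_([tuple] : 0.-tuple T)]
  | m.+1 => [the {sigma_finite_measure set (m.+1.-tuple T) -> \bar R}
               of tcons_measure mu (tuple_measure mu m)]
  end.

Lemma tuple_measure_box (mu : {sigma_finite_measure set T -> \bar R}) (n : nat)
    (A : 'I_n -> set T) :
  (forall i, measurable (A i)) ->
  tuple_measure mu n [set t | forall i, A i (tnth t i)] =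
  (\prod_(i < n) mu (A i))%E.
Proof.
elim: n A => [|n IHn] A mA /=.
  by rewrite big_ord0 diracE mem_set// => -[].
rewrite big_ord_recl -IHn; last by move=> i; exact: mA.
rewrite -product_measure1E//.
  congr product_measure1; apply/seteqP; split=> [[x t] /= h|[x t] /= [Ax At] i].
    split; first by have := h ord0.
    by move=> i; have := h (lift ord0 i); rewrite tnthS.
  by case: (unliftP ord0 i) => [j ->|->]//; rewrite tnthS.
rewrite [X in measurable X](_ : _ =
    \bigcap_(i in [set: 'I_n]) ((fun t => tnth t i) @^-1` A (lift ord0 i))).
  apply: fin_bigcap_measurable => // i _.
  by rewrite -[X in measurable X]setTI; exact: measurable_tnth.
by apply/seteqP; split=> t /= h i; [move=> _|]; exact: h.
Qed.

End tuple_measure.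

(* R with its sigma-algebra of Lebesgue-measurable (not only Borel) sets, the *)
(* domain of completed_lebesgue_measure.                                      *)
Definition lebesgueR (R : realType) :=
  caratheodory_type ((wlength (@idfun R))^*)%mu.

Definition lebesgue_measurable (R : realType) (A : set R) : Prop :=
  ((wlength (@idfun R))^*)%mu.-cara.-measurable A.

Definition lebesgue_measureN (R : realType) (N : nat) :
    {sigma_finite_measure set (N.-tuple (lebesgueR R)) -> \bar R} :=
  tuple_measure (@completed_lebesgue_measure R) N.

(* Directed multigraphs on N nodes with M labelled edges; loops and           *)
(* repetitions are allowed.                                                   *)
Definition digraph (N M : nat) := {ffun 'I_M -> 'I_N * 'I_N}.

(* Law of the edges: independent, each uniform on the N * N ordered pairs.    *)
Definition graph_prob (R : realType) (N M : nat) (E : set (digraph N M)) : R :=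
  \sum_(g : digraph N M | g \in E) \prod_(e < M) (#|{: 'I_N * 'I_N}|%:R)^-1.

Definition partition_function (R : realType) (h : R -> R) (J : R -> R -> R)
    (N M : nat) (g : digraph N M) : \bar R :=
  (\int[@lebesgue_measureN R N]_x
     ((\prod_(u < N) h (tnth x u)) *
      (\prod_(e < M) J (tnth x (g e).1) (tnth x (g e).2)))%:E)%E.

(* lne 0 = -oo, so a vanishing partition function is at infinite distance     *)
(* from z and counts as a deviation.                                          *)
Definition right_converging (R : realType) (h : R -> R) (J : R -> R -> R)
    (c : R) : Prop :=
  exists z : R, forall eps : R, 0 < eps ->
    graph_prob R [set g : digraph N (Num.truncn (c * N%:R)) |
      (eps%:E < `| (N%:R^-1)%:E * lne (partition_function h J g) - z%:E |)%E]
    @[N --> \oo] --> (0 : R).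

Definition gaussian_potential (R : realType) (x : R) : R := expR (- x ^+ 2).

(* The index r = 1, 2, ... is shifted to start at 0; disjointness of the A_r  *)
(* leaves at most one nonzero term in the series.                             *)
Definition block_potential (R : realType) (gamma : nat -> R) (A : nat -> set R)
    (x y : R) : R :=
  1 - limn [series gamma r * \1_(A r `*` A r) (x, y)]_r.

(* Main.v *)
(* Points of a common hard class [A r] exclude each other across an edge, while
   the class [A r0] is free.  After merging the hard classes of large index into a
   free one, [Z] is a partition function over finitely many colours, and the true
   one is recovered by dominated convergence with all estimates uniform.

   Since any node can be recoloured by the free class, inserting an edge changes
   [ln Z] by a bounded amount; hence [ln Z] concentrates around its mean (variance
   linear in [N], Chebyshev).

   The mean is nearly superadditive by interpolation.  Inserting an edge [e] changes
   [ln Z] by [ln (1 - p e)], where all powers of the kernel [p] are positive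
   semidefinite, and so is [- ln (1 - p)].  Hence the expected change is larger for
   an edge uniform on all nodes than for one uniform inside a random block of a
   partition into equal blocks.  In the latter graph [ln Z] splits over the blocks,
   whose edge numbers are binomial and cost a square-root error. *)

Require Import Defs.
From mathcomp Require Import all_boot all_order all_algebra.
From mathcomp Require Import all_classical all_reals all_analysis.
From mathcomp Require Import measurable_realfun ring lra.
Import Order.TTheory GRing.Theory Num.Theory.
Import numFieldNormedType.Exports.

Set Implicit Arguments.
Unset Strict Implicit.
Unset Printing Implicit Defensive.

Local Open Scope classical_set_scope.
Local Open Scope ring_scope.

(** * Means over independent edges *)

Section IteratedExpectation.
Context {R : realType} {T : finType}.
Implicit Types (mu nu : T -> R) (f g : seq T -> R) (s : seq T).

Definition symmetric_fun (U : Type) (f : seq T -> U) :=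
  forall s t, perm_eq s t -> f s = f t.

(** Edges form a sequence, so that inserting an edge is a [cons] and inductions peel off one edge.
    [sum_ffun_iid_mean] below identifies this with the sum over labelled graphs. *)
Fixpoint iid_mean mu (n : nat) f : R :=
  if n is m.+1 then \sum_x mu x * iid_mean mu m (fun s => f (x :: s))
  else f [::].

Definition prob_law mu := (forall x, 0 <= mu x) /\ \sum_x mu x = 1.

Lemma symmetric_cons (U : Type) (f : seq T -> U) x :
  symmetric_fun f -> symmetric_fun (fun s => f (x :: s)).
Proof. by move=> sf s t st; apply: sf; rewrite perm_cons. Qed.

Lemma symmetric_swap (U : Type) (f : seq T -> U) x y s :
  symmetric_fun f -> f (x :: y :: s) = f (y :: x :: s).
Proof. by apply; rewrite (perm_catCA [:: x] [:: y] s). Qed.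

Lemma eq_iid_mean mu n f g :
  (forall s, size s = n -> f s = g s) -> iid_mean mu n f = iid_mean mu n g.
Proof.
elim: n f g => [|n IH] f g fg /=; first exact: fg.
by apply: eq_bigr => x _; congr (_ * _); apply: IH => s ss; rewrite fg//= ss.
Qed.

Lemma le_iid_mean mu n f g : prob_law mu ->
  (forall s, size s = n -> f s <= g s) -> iid_mean mu n f <= iid_mean mu n g.
Proof.
move=> [mu0 _]; elim: n f g => [|n IH] f g fg /=; first exact: fg.
by apply: ler_sum => x _; apply: ler_wpM2l => //; apply: IH => s ss; rewrite fg//= ss.
Qed.

Lemma iid_meanD mu n f g :
  iid_mean mu n (fun s => f s + g s) = iid_mean mu n f + iid_mean mu n g.
Proof.
elim: n f g => [|n IH] f g //=.
by rewrite -big_split/=; apply: eq_bigr => x _; rewrite IH mulrDr.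
Qed.

Lemma iid_meanZ mu n a f :
  iid_mean mu n (fun s => a * f s) = a * iid_mean mu n f.
Proof.
elim: n f => [|n IH] f //=.
by rewrite big_distrr/=; apply: eq_bigr => x _; rewrite IH mulrCA.
Qed.

Lemma iid_mean_sum (I : Type) (r : seq I) (P : pred I) mu n (F : I -> seq T -> R) :
  iid_mean mu n (fun s => \sum_(i <- r | P i) F i s) =
  \sum_(i <- r | P i) iid_mean mu n (F i).
Proof.
elim: n F => [|n IH] F //=.
under eq_bigr => x _ do rewrite IH big_distrr /=.
by rewrite exchange_big.
Qed.

Lemma iid_mean_cst mu n a : prob_law mu -> iid_mean mu n (fun=> a) = a.
Proof.
move=> [_ mu1]; elim: n => [|n IH] //=.
by under eq_bigr => x _ do rewrite IH; rewrite -big_distrl/= mu1 mul1r.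
Qed.

(* Replacing the law of one edge at a time. *)
Lemma iid_mean_compare mu nu n f : prob_law mu -> prob_law nu -> symmetric_fun f ->
  (forall s, \sum_x nu x * f (x :: s) <= \sum_x mu x * f (x :: s)) ->
  iid_mean nu n f <= iid_mean mu n f.
Proof.
move=> pmu pnu; elim: n f => [|n IH] f sf fle //=.
apply: (@le_trans _ _ (\sum_x mu x * iid_mean nu n (fun s => f (x :: s)))).
  have E (la : T -> R) : \sum_x la x * iid_mean nu n (fun s => f (x :: s)) =
      iid_mean nu n (fun s => \sum_x la x * f (x :: s)).
    by rewrite iid_mean_sum; apply: eq_bigr => x _; rewrite iid_meanZ.
  by rewrite !E; apply: le_iid_mean.
case: pmu => mu0 _; apply: ler_sum => x _; apply: ler_wpM2l => //.
apply: IH; first exact: symmetric_cons.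
move=> s; have := fle (x :: s).
under eq_bigr => y _ do rewrite (symmetric_swap _ _ _ sf).
by under [X in _ <= X]eq_bigr => y _ do rewrite (symmetric_swap _ _ _ sf).
Qed.

(** Condition on the first edge [x]. The conditional means [y x] all lie within [D] of one number,
    the mean [y0] of [f] over one edge fewer, so each edge adds at most [D ^+ 2] to the variance. *)
Lemma iid_variance mu n f (D : R) : prob_law mu -> symmetric_fun f ->
  (forall x s, `|f (x :: s) - f s| <= D) ->
  iid_mean mu n (fun s => f s ^+ 2) <= iid_mean mu n f ^+ 2 + n%:R * D ^+ 2.
Proof.
move=> pmu; have [mu0 mu1] := pmu.
elim: n f => [|n IH] f sf fD /=; first by rewrite mul0r addr0.
pose y x := iid_mean mu n (fun s => f (x :: s)).
pose y0 := iid_mean mu n f; pose yb := \sum_x mu x * y x.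
rewrite -[X in _ <= X ^+ 2 + _]/yb.
have yD x : (y x - y0) ^+ 2 <= D ^+ 2.
  have D0 : 0 <= D by apply: le_trans (fD x [::]); rewrite normr_ge0.
  have -> : y x - y0 = iid_mean mu n (fun s => f (x :: s) - f s).
    rewrite iid_meanD -[X in _ = _ + X]/(iid_mean mu n (fun s => - f s)).
    congr (_ + _); rewrite -mulN1r -iid_meanZ.
    by apply: eq_iid_mean => s _; rewrite mulN1r.
  have l1 : iid_mean mu n (fun s => f (x :: s) - f s) <= D.
    rewrite -[leRHS](iid_mean_cst n D pmu); apply: le_iid_mean => // s _.
    by have := fD x s; rewrite ler_norml => /andP[].
  have l2 : - D <= iid_mean mu n (fun s => f (x :: s) - f s).
    rewrite -[leLHS](iid_mean_cst n (- D) pmu); apply: le_iid_mean => // s _.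
    by have := fD x s; rewrite ler_norml => /andP[].
  by rewrite -[leLHS]real_normK ?num_real// lerXn2r ?nnegrE// ler_norml l1 l2.
apply: (@le_trans _ _ (\sum_x mu x * (y x ^+ 2 + n%:R * D ^+ 2))).
  apply: ler_sum => x _; apply: ler_wpM2l => //; apply: IH.
    exact: symmetric_cons.
  by move=> z s; rewrite (symmetric_swap _ _ _ sf); exact: fD.
(* The spread of [y] about [y0] exceeds its variance by [(yb - y0) ^+ 2], which may be dropped. *)
have -> : \sum_x mu x * (y x ^+ 2 + n%:R * D ^+ 2) =
    \sum_x mu x * (y x - y0) ^+ 2 + (yb ^+ 2 - (yb - y0) ^+ 2) + n%:R * D ^+ 2.
  under eq_bigr => x _.
    rewrite (_ : _ * _ = mu x * (y x - y0) ^+ 2 + (mu x * y x) * (2 * y0)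
      + mu x * (n%:R * D ^+ 2 - y0 ^+ 2)); last by ring.
    over.
  rewrite !big_split/= -!big_distrl/= -/yb mu1; ring.
have : \sum_x mu x * (y x - y0) ^+ 2 <= D ^+ 2.
  rewrite -[leRHS]mul1r -mu1 big_distrl/=.
  by apply: ler_sum => x _; apply: ler_wpM2l.
have := sqr_ge0 (yb - y0).
rewrite -natr1 mulrDl mul1r; lra.
Qed.

End IteratedExpectation.

(** * Binomial means *)

Section Binomial.
Context {R : realType}.
Implicit Types (G : nat -> R) (p : R).

(** Mean of [G] at a binomial variable with parameters [n] and [p], by conditioning on the first
    trial. *)
Fixpoint bin_mean p (n : nat) G : R :=
  if n is m.+1 then
    (1 - p) * bin_mean p m G + p * bin_mean p m (fun i => G i.+1)
  else G 0%N.

Lemma le_bin_mean p n G G' : 0 <= p <= 1 ->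
  (forall m, (m <= n)%N -> G m <= G' m) -> bin_mean p n G <= bin_mean p n G'.
Proof.
move=> /andP[p0 p1]; elim: n G G' => [|n IH] G G' GG /=; first exact: GG.
apply: lerD; apply: ler_wpM2l; rewrite ?subr_ge0//; apply: IH => m mn.
  by apply: GG; rewrite ltnW.
exact: GG.
Qed.

Lemma bin_meanD p n G G' :
  bin_mean p n (fun m => G m + G' m) = bin_mean p n G + bin_mean p n G'.
Proof. by elim: n G G' => [|n IH] G G' //=; rewrite !IH; ring. Qed.

Lemma bin_meanZ p n a G : bin_mean p n (fun m => a * G m) = a * bin_mean p n G.
Proof. by elim: n G => [|n IH] G //=; rewrite !IH; ring. Qed.

Lemma bin_mean_cst p n a : bin_mean p n (fun=> a) = a.
Proof. by elim: n => [|n IH] //=; rewrite IH; ring. Qed.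

Lemma bin_mean_sqr p n (a : R) :
  bin_mean p n (fun m => (m%:R - a) ^+ 2) = n%:R * p * (1 - p) + (n%:R * p - a) ^+ 2.
Proof.
elim: n a => [|n IH] a /=; first by ring.
rewrite IH; under eq_fun do rewrite -natr1 -addrA -opprB -[a - 1]opprK opprK.
have -> : (fun m : nat => (m%:R - (a - 1)) ^+ 2) = (fun m : nat => (m%:R - (a - 1)) ^+ 2 : R) by [].
by rewrite IH -natr1; ring.
Qed.

(* [|m - a| <= ((m - a)^2 / x + x) / 2] reduces the deviation to the second moment. *)
Lemma bin_mean_ge p n G (m0 : nat) (D x : R) : 0 <= p <= 1 -> 0 < x -> 0 <= D ->
  (forall m, `|G m.+1 - G m| <= D) ->
  G m0 - D * ((n%:R * p + (n%:R * p - m0%:R) ^+ 2) / x + x) / 2 <= bin_mean p n G.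
Proof.
move=> p01 x0 D0 GD.
(* Telescoping the increments in either direction from [m0]. *)
have G_lip m : G m0 - D * `|m%:R - m0%:R| <= G m.
  have up i j : `|G (i + j)%N - G i| <= D * j%:R.
    elim: j => [|j IH]; first by rewrite addn0 subrr normr0 mulr0.
    rewrite addnS -natr1 mulrDr mulr1.
    by have := ler_distD (G (i + j)%N) (G (i + j).+1) (G i); have := GD (i + j)%N; lra.
  have [mm|/ltnW mm] := leqP m0 m.
    have := up m0 (m - m0)%N; rewrite subnKC// natrB//.
    rewrite (ger0_norm (x := m%:R - m0%:R)) ?subr_ge0 ?ler_nat//.
    by rewrite ler_norml => /andP[]; lra.
  have := up m (m0 - m)%N; rewrite subnKC// natrB//.
  rewrite (ler0_norm (x := m%:R - m0%:R)) ?subr_le0 ?ler_nat// opprB.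
  by rewrite ler_norml => /andP[]; lra.
apply: (@le_trans _ _ (bin_mean p n (fun m =>
    (G m0 - D * x / 2) + - (D / (2 * x)) * (m%:R - m0%:R) ^+ 2))); last first.
  apply: le_bin_mean => // m _; apply: le_trans (G_lip m).
  rewrite -subr_ge0.
  have -> : G m0 - D * `|m%:R - m0%:R| - (G m0 - D * x / 2 +
      - (D / (2 * x)) * (m%:R - m0%:R) ^+ 2) =
      D * (`|m%:R - m0%:R| - x) ^+ 2 / (2 * x).
    rewrite -[(m%:R - m0%:R) ^+ 2]real_normK ?num_real//.
    by field; rewrite gt_eqF.
  apply: divr_ge0; last by rewrite mulr_ge0// ltW.
  by rewrite mulr_ge0// sqr_ge0.
rewrite bin_meanD bin_meanZ bin_mean_cst bin_mean_sqr.
rewrite -subr_ge0.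
have -> : G m0 - D * x / 2 +
   - (D / (2 * x)) * (n%:R * p * (1 - p) + (n%:R * p - m0%:R) ^+ 2) -
   (G m0 - D * ((n%:R * p + (n%:R * p - m0%:R) ^+ 2) / x + x) / 2) =
   D * (n%:R * p ^+ 2) / (2 * x) by field; rewrite gt_eqF.
apply: divr_ge0; last by rewrite mulr_ge0// ltW.
by rewrite mulr_ge0// mulr_ge0// sqr_ge0.
Qed.

Lemma bin_mean_ge_last p n G : 0 <= p <= 1 ->
  (forall m, G m.+1 <= G m) -> G n <= bin_mean p n G.
Proof.
move=> p01 Gd; rewrite -[leLHS](bin_mean_cst p n); apply: le_bin_mean => // m mn.
rewrite -(subnKC mn); elim: (n - m)%N => [|k IH]; first by rewrite addn0.
by rewrite addnS; apply: le_trans IH.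
Qed.

End Binomial.

(** * Positive semidefinite kernels and colourings *)

(* The derivative in [t] of [\sum_e D e * ln (1 - t * p e)] is, by the
   geometric series, a limit of negative combinations of the hypotheses. *)
Lemma sum_ln_le0 (R : realType) (T : finType) (D p : T -> R) :
  (forall e, 0 <= p e < 1) ->
  (forall k, 0 <= \sum_e D e * p e ^+ k) ->
  \sum_e D e * ln (1 - p e) <= 0.
Proof.
move=> p01 Dp.
have tp1 e (t : R) : 0 <= t <= 1 -> 0 <= t * p e < 1.
  have /andP[p0 p1] := p01 e; move=> /andP[t0 t1]; rewrite mulr_ge0//=.
  by apply: le_lt_trans p1; rewrite ler_piMl.
pose dphi (t : R) := \sum_e D e * (- p e / (1 - t * p e)).
pose phi (t : R) := \sum_e D e * ln (1 - t * p e).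
have dphi_le0 (t : R) : 0 <= t <= 1 -> dphi t <= 0.
  move=> t01; rewrite -oppr_ge0 /dphi -sumrN.
  (* Partial sums of the geometric expansion of [- dphi t]. The coefficient of [t ^+ i] is the
     hypothesis [Dp] at exponent [i.+1]. *)
  pose S n := \sum_e D e * p e * series (geometric 1 (t * p e)) n.
  have cS : S n @[n --> \oo] --> \sum_e - (D e * (- p e / (1 - t * p e))).
    apply: cvg_big => [|e _]; first exact: add_continuous.
    rewrite (_ : - _ = D e * p e * (1 / (1 - t * p e))); last by rewrite div1r; ring.
    apply: cvgMr; apply: cvg_geometric_series.
    by have /andP[? ?] := tp1 e t t01; rewrite ger0_norm.
  rewrite -(cvg_lim _ cS)//; apply: limr_ge; first by apply/cvg_ex; eexists; exact: cS.
  apply: nearW => n; rewrite /S.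
  under eq_bigr do rewrite /series/= big_distrr/=.
  rewrite exchange_big/=; apply: sumr_ge0 => i _.
  rewrite (eq_bigr (fun e => t ^+ i * (D e * p e ^+ i.+1))) => [|e _].
    by rewrite -big_distrr/= mulr_ge0// exprn_ge0//; case/andP: t01.
  by rewrite /geometric/= exprMn exprS; ring.
have der (t : R) : 0 <= t <= 1 -> is_derive t (1:R) phi (dphi t).
  move=> t01.
  rewrite (_ : phi = \sum_e (fun t => D e * ln (1 - t * p e))); last first.
    by apply/funext => x; rewrite fct_sumE.
  rewrite /dphi; elim/big_ind2 : _ => [|f f' g g' ? ?|e _].
  - exact: is_derive_cst.
  - exact: is_deriveD.
  have pos : 0 < 1 - t * p e by have /andP[_ ?] := tp1 e t t01; rewrite subr_gt0.
  have d1 : is_derive t (1:R) (fun t => 1 - t * p e) (- p e).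
    apply: is_derive_eq.
    by rewrite scaler0 !add0r mul1r /GRing.scale/= mulr1.
  have d2 := @is_derive1_comp _ (@ln R) (fun t => 1 - t * p e) t _ _ (is_derive1_ln pos) d1.
  rewrite [- p e / _]mulrC.
  exact: (@is_deriveZ _ _ _ _ (D e) _ _ _ d2).
have [|||c cin] := @MVT _ phi dphi 0 1.
- exact: ltr01.
- by move=> x h; apply: der; rewrite !(itvP h).
- apply: derivable_within_continuous => x h.
  by have := der x; rewrite !(itvP h) => /(_ isT) [].
have phi0 : phi 0 = 0 by rewrite /phi big1// => e _; rewrite mul0r subr0 ln1 mulr0.
rewrite phi0 subr0 subr0 mulr1 => E.
rewrite (_ : \sum_e _ = phi 1); last by apply: eq_bigr => e _; rewrite mul1r.
by rewrite E; apply: dphi_le0; rewrite !(itvP cin).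
Qed.

Definition psd (R : realType) (V : finType) (K : V * V -> R) :=
  forall f : V -> R, 0 <= \sum_e K e * (f e.1 * f e.2).

(** * Partition sums over finite colourings *)

Section ColouringModel.
Context {R : realType} {C : finType}.
Variables (w gam : C -> R) (c0 : C).
Hypotheses (w_ge0 : forall a, 0 <= w a) (gam01 : forall a, 0 <= gam a <= 1).
Hypotheses (gam0 : gam c0 = 0) (w0_gt0 : 0 < w c0).

Definition edge_weight (V : finType) (sigma : {ffun V -> C}) (e : V * V) : R :=
  1 - gam (sigma e.1) * (sigma e.1 == sigma e.2)%:R.

Definition colouring_weight (V : finType) (s : seq (V * V)) (sigma : {ffun V -> C}) : R :=
  (\prod_u w (sigma u)) * \prod_(e <- s) edge_weight sigma e.

Definition partition_sum (V : finType) (s : seq (V * V)) : R :=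
  \sum_(sigma : {ffun V -> C}) colouring_weight s sigma.

Definition wsum := \sum_a w a.

Lemma wsum_gt0 : 0 < wsum.
Proof.
rewrite /wsum (bigD1 c0)//=; apply: (lt_le_trans w0_gt0).
by rewrite lerDl sumr_ge0.
Qed.

Lemma edge_weight01 (V : finType) (sigma : {ffun V -> C}) e :
  0 <= edge_weight sigma e <= 1.
Proof.
rewrite /edge_weight; have /andP[g0 g1] := gam01 (sigma e.1).
by case: (_ == _); rewrite ?mulr1 ?mulr0 ?subr0 ?ler01 ?lexx// subr_ge0 g1 lerBlDr lerDl.
Qed.

Lemma prod_edge_weight01 (V : finType) (s : seq (V * V)) (sigma : {ffun V -> C}) :
  0 <= \prod_(e <- s) edge_weight sigma e <= 1.
Proof.
elim: s => [|e s /andP[IH0 IH1]]; first by rewrite big_nil ler01 lexx.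
rewrite big_cons; have /andP[e0 e1] := edge_weight01 sigma e.
by rewrite mulr_ge0// mulr_ile1.
Qed.

Lemma colouring_weight_ge0 (V : finType) (s : seq (V * V)) (sigma : {ffun V -> C}) :
  0 <= colouring_weight s sigma.
Proof.
rewrite mulr_ge0//; first exact: prodr_ge0.
by case/andP: (prod_edge_weight01 s sigma).
Qed.

Lemma colouring_weight_cons (V : finType) e (s : seq (V * V)) (sigma : {ffun V -> C}) :
  colouring_weight (e :: s) sigma = edge_weight sigma e * colouring_weight s sigma.
Proof. by rewrite /colouring_weight big_cons; ring. Qed.

Lemma Z_symmetric (V : finType) : symmetric_fun (@partition_sum V).
Proof.
move=> s t st; apply: eq_bigr => sigma _; congr (_ * _).
exact: perm_big.
Qed.

(** The constant colouring [c0] violates no edge, since [gam c0 = 0]. *)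
Lemma Z_ge (V : finType) (s : seq (V * V)) : w c0 ^+ #|V| <= partition_sum s.
Proof.
rewrite /partition_sum (bigD1 [ffun=> c0])//= [X in X + _](_ : _ = w c0 ^+ #|V|).
  by rewrite lerDl sumr_ge0// => sigma _; exact: colouring_weight_ge0.
rewrite /colouring_weight [X in _ * X]big1_seq ?mulr1.
  by under eq_bigr do rewrite ffunE; rewrite prodr_const.
by move=> e _; rewrite /edge_weight !ffunE gam0 mul0r subr0.
Qed.

Lemma Z_le (V : finType) (s : seq (V * V)) : partition_sum s <= wsum ^+ #|V|.
Proof.
rewrite -prodr_const (bigA_distr_bigA (fun _ : V => w)); apply: ler_sum => sigma _.
rewrite /colouring_weight -[leRHS]mulr1; apply: ler_wpM2l.
  exact: prodr_ge0.
by case/andP: (prod_edge_weight01 s sigma).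
Qed.

Lemma Z_gt0 (V : finType) (s : seq (V * V)) : 0 < partition_sum s.
Proof. by apply: lt_le_trans (Z_ge s); rewrite exprn_gt0. Qed.

Lemma Z_cons_le (V : finType) e (s : seq (V * V)) : partition_sum (e :: s) <= partition_sum s.
Proof.
apply: ler_sum => sigma _; rewrite colouring_weight_cons ler_piMl ?colouring_weight_ge0//.
by case/andP: (edge_weight01 sigma e).
Qed.

Definition recolour (V : finType) (u : V) (a : C) (sigma : {ffun V -> C}) : {ffun V -> C} :=
  [ffun v => if v == u then a else sigma v].

(* Recolouring an endpoint of the new edge with [c0] removes its constraints. *)
Lemma Z_cons_ge (V : finType) e (s : seq (V * V)) : w c0 / wsum * partition_sum s <= partition_sum (e :: s).
Proof.
rewrite mulrAC ler_pdivrMr ?wsum_gt0//.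
set u := e.1.
pose S0 := \sum_(sigma : {ffun V -> C} | sigma u == c0) colouring_weight s sigma.
apply: (@le_trans _ _ (S0 * wsum)); last first.
  apply: ler_wpM2r; first exact: ltW wsum_gt0.
  rewrite /S0 /partition_sum [leRHS](bigID (fun sigma : {ffun V -> C} => sigma u == c0))/=.
  rewrite -[leLHS]addr0 lerD//.
    apply: ler_sum => sigma /eqP su.
    by rewrite colouring_weight_cons /edge_weight su gam0 mul0r subr0 mul1r.
  by apply: sumr_ge0 => sigma _; exact: colouring_weight_ge0.
(* A colouring corresponds to the pair of its version recoloured at [u] and its old colour at [u].
   The factor [wsum] sums over the latter. *)
have -> : S0 * wsum = \sum_(sigma : {ffun V -> C})
    w (sigma u) * colouring_weight s (recolour u c0 sigma).
  rewrite /S0 /wsum big_distrlr/= pair_big/=.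
  rewrite (reindex (fun sigma : {ffun V -> C} => (recolour u c0 sigma, sigma u)))/=.
    by apply: eq_big => [sigma|sigma _]; rewrite ?ffunE ?eqxx// mulrC.
  exists (fun x => recolour u x.2 x.1) => [sigma _|[sigma a]].
    by apply/ffunP => v; rewrite !ffunE; case: eqP => [->|].
  rewrite inE/= andbT => /eqP su; congr pair; last by rewrite ffunE eqxx.
  by apply/ffunP => v; rewrite !ffunE; case: eqP => [->|].
rewrite /partition_sum mulr_sumr; apply: ler_sum => sigma _.
rewrite /colouring_weight.
have -> : w (sigma u) * (\prod_v w (recolour u c0 sigma v) *
     \prod_(e <- s) edge_weight (recolour u c0 sigma) e) =
   w c0 * (\prod_v w (sigma v) * \prod_(e <- s) edge_weight (recolour u c0 sigma) e).
  rewrite !mulrA; congr (_ * _).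
  rewrite (bigD1 u)//= [in RHS](bigD1 u)//= ffunE eqxx mulrCA; congr (_ * (_ * _)).
  by apply: eq_bigr => v /negPf vu; rewrite ffunE vu.
apply: ler_wpM2l; first exact: ltW.
apply: ler_wpM2l; first exact: prodr_ge0.
(* No edge weight decreases under recolouring: an edge meeting [u] gets weight 1, the others keep
   theirs. *)
rewrite !big_seq; apply: ler_prod => i _; have /andP[-> _]/= := edge_weight01 sigma i.
rewrite /edge_weight !ffunE lerD2l lerN2.
have g0 a (b : bool) : 0 <= gam a * b%:R by rewrite mulr_ge0//; case/andP: (gam01 a).
have [_|_] := eqVneq i.1 u; first by rewrite gam0 mul0r.
have [_|_] := eqVneq i.2 u; last exact: lexx.
by have [->|_] := eqVneq (sigma i.1) c0; [rewrite gam0 !mul0r|rewrite mulr0].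
Qed.

Definition lnZ (V : finType) (s : seq (V * V)) := ln (partition_sum s).
(** The largest loss of [lnZ] per inserted edge; it depends neither on the graph nor on the number
    of nodes. *)
Definition lnZ_lip := - ln (w c0 / wsum).

Lemma lnZ_cons (V : finType) e (s : seq (V * V)) :
  lnZ s - lnZ_lip <= lnZ (e :: s) <= lnZ s.
Proof.
have d0 : 0 < w c0 / wsum by rewrite divr_gt0// wsum_gt0.
have Zs := Z_gt0 s; have Ze := Z_gt0 (e :: s).
rewrite /lnZ /lnZ_lip opprK -lnM ?posrE// !ler_ln ?posrE ?mulr_gt0 ?invr_gt0 ?wsum_gt0//.
by rewrite mulrC Z_cons_ge Z_cons_le.
Qed.

Lemma lnZ_symmetric (V : finType) : symmetric_fun (@lnZ V).
Proof. by move=> s t st; rewrite /lnZ (Z_symmetric st). Qed.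

(** The factor splits as a sum over colours [a], with weight [gam a >= 0], of the indicator that
    both endpoints have colour [a]. Each indicator restricts [f] to one colour class, where
    positivity of [K] applies. *)
Lemma psd_edge (V : finType) (sigma : {ffun V -> C}) (K : V * V -> R) (f : V -> R) : psd K ->
  0 <= \sum_e (gam (sigma e.1) * (sigma e.1 == sigma e.2)%:R) * K e * (f e.1 * f e.2).
Proof.
move=> Kpsd.
rewrite (_ : \sum_e _ = \sum_a gam a * \sum_e K e *
    ((f e.1 * (sigma e.1 == a)%:R) * (f e.2 * (sigma e.2 == a)%:R))).
  apply: sumr_ge0 => a _; apply: mulr_ge0; first by case/andP: (gam01 a).
  exact: (Kpsd (fun v => f v * (sigma v == a)%:R)).
under [RHS]eq_bigr do rewrite big_distrr/=.
rewrite exchange_big/=; apply: eq_bigr => e _.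
rewrite (bigD1 (sigma e.1))//= eqxx big1 ?addr0.
  by rewrite mulr1 (eq_sym (sigma e.2)); ring.
by move=> a ane; rewrite eq_sym (negPf ane) !(mulr0, mul0r).
Qed.

(* [1 - partition_sum (e :: s) / partition_sum s] is the Gibbs average of the kernels of [psd_edge]. *)
Lemma psd_ratio_pow (V : finType) (s : seq (V * V)) k :
  psd (fun e => (1 - partition_sum (e :: s) / partition_sum s) ^+ k).
Proof.
have Z0 := Z_gt0 s.
elim: k => [|k IH] f.
  under eq_bigr do rewrite expr0 mul1r.
  by rewrite -(pair_bigA _ (fun u v => f u * f v)) -big_distrlr/= -expr2 sqr_ge0.
pose K e := (1 - partition_sum (e :: s) / partition_sum s) ^+ k.
rewrite (_ : \sum_e _ = (partition_sum s)^-1 * \sum_(sigma : {ffun V -> C}) colouring_weight s sigma *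
   \sum_e (gam (sigma e.1) * (sigma e.1 == sigma e.2)%:R) * K e * (f e.1 * f e.2)).
  apply: mulr_ge0; first by rewrite invr_ge0 ltW.
  apply: sumr_ge0 => sigma _.
  by rewrite mulr_ge0 ?colouring_weight_ge0//; exact: psd_edge.
under [in RHS]eq_bigr do rewrite big_distrr/=.
rewrite exchange_big/= big_distrr/=; apply: eq_bigr => e _.
rewrite exprS -/(K e).
(* One factor of the power is replaced by its Gibbs average; the remaining power is the kernel [K],
   positive semidefinite by induction. *)
rewrite (_ : 1 - partition_sum (e :: s) / partition_sum s = (partition_sum s)^-1 * \sum_(sigma : {ffun V -> C})
   colouring_weight s sigma * (gam (sigma e.1) * (sigma e.1 == sigma e.2)%:R)).
  rewrite -!mulrA; congr (_ * _); rewrite big_distrl/=.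
  by apply: eq_bigr => sigma _; ring.
rewrite -[X in X - _](mulVf (lt0r_neq0 Z0)) mulrC -mulrBl mulrC; congr (_ * _).
rewrite /partition_sum -sumrB; apply: eq_bigr => sigma _.
by rewrite colouring_weight_cons /edge_weight; ring.
Qed.

(** The insertion changes [lnZ] by [ln (1 - p e)]. As the powers of [p] are positive semidefinite,
    [sum_ln_le0] applies with the signed weights [mu - nu]; equal total masses cancel the common
    term [lnZ s]. *)
Lemma lnZ_law_le (V : finType) (mu nu : V * V -> R) (s : seq (V * V)) :
  (forall K, psd K -> \sum_e nu e * K e <= \sum_e mu e * K e) ->
  \sum_e nu e = \sum_e mu e ->
  \sum_e mu e * lnZ (e :: s) <= \sum_e nu e * lnZ (e :: s).
Proof.
move=> numu sumE; have Z0 := Z_gt0 s.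
have d0 : 0 < w c0 / wsum by rewrite divr_gt0// wsum_gt0.
pose p e := 1 - partition_sum (e :: s) / partition_sum s.
have lnE e : lnZ (e :: s) = ln (1 - p e) + lnZ s.
  by rewrite /lnZ /p subKr ln_div ?posrE ?Z_gt0// subrK.
have : \sum_e (mu e - nu e) * ln (1 - p e) <= 0.
  apply: sum_ln_le0 => [e|k].
    rewrite /p subr_ge0 ler_pdivrMr// mul1r Z_cons_le/=.
    by rewrite ltrBlDr ltrDl divr_gt0// Z_gt0.
  under eq_bigr do rewrite mulrBl.
  rewrite sumrB subr_ge0; apply: numu; exact: psd_ratio_pow.
under eq_bigr do rewrite mulrBl.
rewrite sumrB subr_le0 => le.
under eq_bigr do rewrite lnE mulrDr.
under [leRHS]eq_bigr do rewrite lnE mulrDr.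
by rewrite !big_split/= -!big_distrl/= sumE lerD2r.
Qed.

End ColouringModel.

(** * Interpolation *)

Lemma bin_mean_sum (R : realType) (I : Type) (r : seq I) (P : pred I) p n
    (G : I -> nat -> R) :
  bin_mean p n (fun m => \sum_(i <- r | P i) G i m) =
  \sum_(i <- r | P i) bin_mean p n (G i).
Proof.
elim: n G => [|n IH] G //=.
by rewrite !IH !big_distrr/= -big_split.
Qed.

Section ChangeOfLaw.
Context {R : realType}.

Lemma eq_iid_mean_supp (T : finType) (mu : T -> R) n (f g : seq T -> R) :
  (forall s, all (fun x => mu x != 0) s -> f s = g s) ->
  iid_mean mu n f = iid_mean mu n g.
Proof.
elim: n f g => [|n IH] f g fg /=; first exact: fg.
apply: eq_bigr => x _; have [->|mux] := eqVneq (mu x) 0; first by rewrite !mul0r.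
by congr (_ * _); apply: IH => s ss; rewrite fg//= mux.
Qed.

Lemma eq_iid_mean_law (T : finType) (mu nu : T -> R) n (f : seq T -> R) :
  mu =1 nu -> iid_mean mu n f = iid_mean nu n f.
Proof. by move=> /funext ->. Qed.

Lemma iid_mean_reindex (T T' : finType) (phi : T -> T') (mu : T' -> R) n
    (f : seq T' -> R) : bijective phi ->
  iid_mean mu n f = iid_mean (mu \o phi) n (fun s => f (map phi s)).
Proof.
move=> bphi; elim: n f => [|n IH] f //=.
rewrite (reindex phi)/=; last exact: onW_bij.
by apply: eq_bigr => x _; rewrite IH.
Qed.

(* The number of edges that [pi] retains is binomial, and given this number
   the retained edges are again independent. *)
Lemma iid_mean_pmap (T T' : finType) (pi : T -> option T') (mu : T -> R)
    (nu : T' -> R) p n (g : seq T' -> R) :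
  \sum_x mu x = 1 -> \sum_y nu y = 1 ->
  (forall y, \sum_(x | pi x == Some y) mu x = p * nu y) ->
  iid_mean mu n (fun s => g (pmap pi s)) =
  bin_mean p n (fun m => iid_mean nu m g).
Proof.
move=> mu1 nu1 mupi.
(* The image law under [pi] has mass [1 - p] at [None] and [p * nu y] at [Some y]. *)
have split_sum (H : option T' -> R) : \sum_x mu x * H (pi x) =
    (1 - p) * H None + p * \sum_y nu y * H (Some y).
  have E (K : option T' -> R) :
      \sum_(o : option T') K o = K None + \sum_y K (Some y).
    rewrite (bigD1 None)//=; congr (_ + _).
    rewrite (reindex_omap Some id)/=; last by case.
    by apply: eq_bigl => y; rewrite eqxx.
  have muN : \sum_(x | pi x == None) mu x = 1 - p.
    apply/eqP; rewrite eq_sym subr_eq -mu1 (partition_big pi xpredT)//= E.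
    apply/eqP; congr (_ + _); under eq_bigr do rewrite mupi.
    by rewrite -big_distrr/= nu1 mulr1.
  rewrite (partition_big pi xpredT)//= E -muN; congr (_ + _).
    by rewrite big_distrl/=; apply: eq_bigr => x /eqP ->.
  rewrite big_distrr/=; apply: eq_bigr => y _.
  by rewrite mulrA -mupi big_distrl/=; apply: eq_bigr => x /eqP ->.
elim: n g => [|n IH] g //=.
(* [H o] is the mean over the other edges when the first one has image [o]. *)
pose H o := bin_mean p n (fun m => iid_mean nu m (fun s => g (oapp (cons^~ s) s o))).
rewrite (eq_bigr (fun x => mu x * H (pi x))) => [|x _].
  rewrite split_sum; congr (_ + _ * _).
  by rewrite bin_mean_sum; apply: eq_bigr => y _; rewrite bin_meanZ.
congr (_ * _); rewrite /H -IH; apply: eq_iid_mean => s _.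
by case: (pi x).
Qed.

End ChangeOfLaw.

Lemma ln_prod (R : realType) (I : Type) (r : seq I) (F : I -> R) :
  (forall i, 0 < F i) -> ln (\prod_(i <- r) F i) = \sum_(i <- r) ln (F i).
Proof.
move=> F0; elim: r => [|i r IH]; first by rewrite !big_nil ln1.
by rewrite !big_cons lnM ?posrE ?IH// prodr_gt0.
Qed.

Section Superadditivity.
Context {R : realType} {C : finType}.
Variables (w gam : C -> R) (c0 : C).
Hypotheses (w_ge0 : forall a, 0 <= w a) (gam01 : forall a, 0 <= gam a <= 1).
Hypotheses (gam0 : gam c0 = 0) (w0_gt0 : 0 < w c0).

Local Notation Z := (partition_sum w gam).
Local Notation lnZ := (lnZ w gam).

Definition edge_unif (V : finType) (e : V * V) : R := #|{: V * V}|%:R^-1.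

Definition mean_lnZ (V : finType) n := iid_mean (@edge_unif V) n (@lnZ V).

Lemma prob_edge_unif (V : finType) : (0 < #|V|)%N -> prob_law (@edge_unif V).
Proof.
move=> V0; split=> [e|]; first by rewrite invr_ge0.
by rewrite /edge_unif sumr_const -[LHS]mulr_natr mulVf// pnatr_eq0 card_prod muln_eq0 orbb -lt0n.
Qed.

Lemma Z_map (V V' : finType) (phi : V -> V') (s : seq (V * V)) : bijective phi ->
  Z (map (fun e => (phi e.1, phi e.2)) s) = Z s.
Proof.
move=> bphi; have [psi phiK psiK] := bphi.
rewrite /Z (reindex (fun sigma : {ffun V -> C} => [ffun v => sigma (psi v)]))/=.
  apply: eq_bigr => sigma _; rewrite /colouring_weight; congr (_ * _).
    rewrite (reindex phi)/=; last exact: onW_bij.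
    by apply: eq_bigr => v _; rewrite ffunE phiK.
  rewrite big_map; apply: eq_bigr => e _.
  by rewrite /edge_weight/= !ffunE !phiK.
by exists (fun sigma : {ffun V' -> C} => [ffun v => sigma (phi v)]) => sigma _;
  apply/ffunP => v; rewrite !ffunE ?phiK ?psiK.
Qed.

Lemma mean_lnZ_card (V V' : finType) n : #|V| = #|V'| -> mean_lnZ V n = mean_lnZ V' n.
Proof.
move=> VV'; have [phi bphi] : exists phi : V -> V', bijective phi.
  exists (fun v => enum_val (cast_ord VV' (enum_rank v))).
  apply: (bij_comp (@enum_val_bij V')); apply: bij_comp (@enum_rank_bij V).
  by exists (cast_ord (esym VV')); [exact: cast_ordK|exact: cast_ordKV].
have bphi2 : bijective (fun e : V * V => (phi e.1, phi e.2)).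
  have [psi phiK psiK] := bphi.
  by exists (fun e => (psi e.1, psi e.2)) => -[a b] /=; rewrite ?phiK ?psiK.
rewrite /mean_lnZ [RHS](iid_mean_reindex _ _ _ bphi2).
under [RHS]eq_iid_mean do rewrite /lnZ Z_map//.
by apply: eq_iid_mean_law => e; rewrite /edge_unif/= !card_prod VV'.
Qed.

Lemma mean_lnZ_lip (V : finType) n : (0 < #|V|)%N ->
  mean_lnZ V n - lnZ_lip w c0 <= mean_lnZ V n.+1 <= mean_lnZ V n.
Proof.
move=> V0; have pU := prob_edge_unif V0.
have -> : mean_lnZ V n - lnZ_lip w c0 =
    \sum_(e : V * V) edge_unif e * iid_mean (@edge_unif V) n (fun s => lnZ s - lnZ_lip w c0).
  rewrite -big_distrl/= (proj2 pU) mul1r iid_meanD; congr (_ + _).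
  by rewrite iid_mean_cst.
have -> : mean_lnZ V n = \sum_(e : V * V) edge_unif e * iid_mean (@edge_unif V) n (@lnZ V).
  by rewrite -big_distrl/= (proj2 pU) mul1r.
have lip e (s : seq (V * V)) := @lnZ_cons _ _ _ _ c0 w_ge0 gam01 gam0 w0_gt0 V e s.
rewrite /mean_lnZ/=; apply/andP; split; apply: ler_sum => e _;
  (apply: ler_wpM2l; first exact: (proj1 pU)); apply: le_iid_mean => // s _;
  by case/andP: (lip e s).
Qed.

(** * Adding leftover nodes *)

Section Remainder.
Variables V V' : finType.

Definition left_edge (e : (V + V') * (V + V')) : option (V * V) :=
  if e is (inl u, inl v) then Some (u, v) else None.

(** Extend each colouring of [V] by the free colour [c0] on [V']: edges meeting [V'] then have
    weight 1. *)
Lemma Z_left (s : seq ((V + V') * (V + V'))) :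
  w c0 ^+ #|V'| * Z (pmap left_edge s) <= Z s.
Proof.
pose ext (tau : {ffun V -> C}) : {ffun V + V' -> C} :=
  [ffun x => if x is inl u then tau u else c0].
pose res (sigma : {ffun V + V' -> C}) : {ffun V -> C} := [ffun u => sigma (inl u)].
have extK tau : res (ext tau) = tau by apply/ffunP => u; rewrite !ffunE.
rewrite /Z [leRHS](bigID (fun sigma => ext (res sigma) == sigma))/= -[leLHS]addr0.
apply: lerD; last by apply: sumr_ge0 => sigma _; exact: colouring_weight_ge0.
rewrite (reindex_onto ext res)/=; last by move=> sigma /eqP.
rewrite big_distrr/= [leRHS](eq_bigl xpredT) => [|tau]; last by rewrite !extK !eqxx.
apply: ler_sum => tau _.
rewrite /colouring_weight big_sumType/= mulrA.
rewrite [X in _ <= _ * X * _](_ : _ = w c0 ^+ #|V'|); last first.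
  by under eq_bigr do rewrite ffunE; rewrite prodr_const.
rewrite [X in _ <= X * _ * _](_ : _ = \prod_u w (tau u)); last first.
  by apply: eq_bigr => u _; rewrite ffunE.
rewrite [X in _ <= X * _]mulrC [leRHS](_ : _ = w c0 ^+ #|V'| * (\prod_u w (tau u)) *
    \prod_(e <- pmap left_edge s) edge_weight gam tau e)//.
congr (_ * _); elim: s => [|[[u|u] [v|v]] s IH]/=; rewrite ?big_nil// !big_cons IH//.
- by rewrite /edge_weight/= !ffunE.
- rewrite /edge_weight/= !ffunE.
  by have [->|] := eqVneq (tau u) c0; rewrite ?gam0 ?mul0r ?mulr0 subr0 mul1r.
- by rewrite /edge_weight/= !ffunE gam0 mul0r subr0 mul1r.
- by rewrite /edge_weight/= !ffunE gam0 mul0r subr0 mul1r.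
Qed.

(** By [Z_left] only the edges inside [V] matter. Their number is binomial and at most [n], and
    fewer edges only increase the mean. *)
Lemma mean_lnZ_sum n : (0 < #|V|)%N ->
  mean_lnZ V n + #|V'|%:R * ln (w c0) <= mean_lnZ (V + V')%type n.
Proof.
move=> V0; have V'0 : (0 < #|{: V + V'}|)%N by rewrite card_sum addn_gt0 V0.
have [pU pU'] := (prob_edge_unif V0, prob_edge_unif V'0).
pose p : R := #|{: V * V}|%:R / #|{: (V + V') * (V + V')}|%:R.
apply: (@le_trans _ _ (iid_mean (@edge_unif (V + V')%type) n
    (fun s => lnZ (pmap left_edge s) + #|V'|%:R * ln (w c0)))); last first.
  apply: le_iid_mean => // s _.
  have Zl : 0 < Z (pmap left_edge s) by apply: (@Z_gt0 _ _ _ _ c0).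
  rewrite /lnZ mulr_natl -lnXn// addrC -lnM ?posrE ?exprn_gt0//.
  rewrite ler_ln ?posrE ?mulr_gt0 ?exprn_gt0 ?(@Z_gt0 _ _ _ _ c0)//.
  exact: Z_left.
rewrite iid_meanD iid_mean_cst// lerD2r.
have -> : iid_mean (@edge_unif (V + V')%type) n (fun s => lnZ (pmap left_edge s)) =
    bin_mean p n (mean_lnZ V).
  apply: iid_mean_pmap; [exact: (proj2 pU')|exact: (proj2 pU)|move=> [u v]].
  rewrite (big_pred1 (inl u, inl v)) => [|[[a|a] [b|b]]]/=; last 4 first.
  - by [].
  - by rewrite xpair_eqE andbF.
  - by [].
  - by [].
  by rewrite /edge_unif /p mulrAC divff ?div1r// pnatr_eq0 card_prod muln_eq0 orbb -lt0n.
apply: (@bin_mean_ge_last _ _ _ (mean_lnZ V)); last by move=> m; case/andP: (mean_lnZ_lip m V0).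
rewrite divr_ge0//= ler_pdivrMr ?mul1r ?ler_nat.
  by rewrite !card_prod leq_mul// card_sum leq_addr.
by rewrite ltr0n card_prod muln_gt0 V'0.
Qed.

End Remainder.

(** * Comparison with disjoint blocks *)

Section Blocks.
Variables k n : nat.
Hypotheses (k_gt0 : (0 < k)%N) (n_gt0 : (0 < n)%N).
Local Notation V := ('I_k * 'I_n)%type.

(** A uniform one among the [k] blocks, then one of its [n ^ 2] ordered pairs uniformly. *)
Definition edge_block (e : V * V) : R :=
  (e.1.1 == e.2.1)%:R * (k%:R * n%:R ^+ 2)^-1.

Definition block_edge (j : 'I_k) (e : V * V) : option ('I_n * 'I_n) :=
  if (e.1.1 == j) && (e.2.1 == j) then Some (e.1.2, e.2.2) else None.

Let kR : k%:R != 0 :> R. Proof. by rewrite pnatr_eq0 -lt0n. Qed.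
Let nR : n%:R != 0 :> R. Proof. by rewrite pnatr_eq0 -lt0n. Qed.

(* Positivity of [K] on the centred indicators [u.1 == j] - 1/k of the blocks. *)
Lemma edge_block_psd (K : V * V -> R) : psd K ->
  \sum_e edge_unif e * K e <= \sum_e edge_block e * K e.
Proof.
move=> Kpsd; rewrite -subr_ge0 -sumrB.
pose f (j : 'I_k) (v : V) : R := (v.1 == j)%:R - k%:R^-1.
rewrite (_ : \sum_e _ = (k%:R * n%:R ^+ 2)^-1 * \sum_j \sum_e K e * (f j e.1 * f j e.2)).
  apply: mulr_ge0; first by rewrite invr_ge0 mulr_ge0// sqr_ge0.
  by apply: sumr_ge0 => j _; exact: Kpsd.
rewrite exchange_big/= big_distrr/=; apply: eq_bigr => e _.
rewrite -big_distrr/=.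
(* Divided by [k * n ^ 2], this is exactly [edge_block e - edge_unif e]. *)
have -> : \sum_j f j e.1 * f j e.2 = (e.1.1 == e.2.1)%:R - k%:R^-1.
  rewrite (eq_bigr (fun j => (e.1.1 == j)%:R * (e.2.1 == j)%:R
      - k%:R^-1 * (e.1.1 == j)%:R - k%:R^-1 * (e.2.1 == j)%:R + k%:R^-1 ^+ 2)).
    have one (a : 'I_k) : \sum_j (a == j)%:R = 1 :> R.
      by rewrite (bigD1 a)//= eqxx big1 ?addr0// => j; rewrite eq_sym => /negPf ->.
    rewrite !(big_split, sumrN)/= -!big_distrr/= !one sumr_const card_ord -(mulr_natr k%:R^-1 k).
    rewrite (bigD1 e.1.1)//= eqxx mul1r big1 ?addr0 => [|j].
      by rewrite (eq_sym e.2.1); field.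
    by rewrite eq_sym => /negPf ->; rewrite mul0r.
  by move=> j _; rewrite /f; ring.
rewrite /edge_block /edge_unif !card_prod !card_ord !natrM.
by field; rewrite kR nR.
Qed.

Lemma sum_edge_block_in (j : 'I_k) y :
  \sum_(e | block_edge j e == Some y) edge_block e = k%:R^-1 * @edge_unif 'I_n y.
Proof.
case: y => a b; rewrite (big_pred1 ((j, a), (j, b))) => [|[[i c] [i' c']]]/=.
  rewrite /edge_block/= eqxx mul1r /edge_unif card_prod card_ord natrM -expr2.
  by rewrite invfM.
rewrite /block_edge/= !xpair_eqE.
by case: (i == j); case: (i' == j) => //=; rewrite andbF.
Qed.

Lemma prob_edge_block : prob_law edge_block.
Proof.
split=> [e|].
  by rewrite /edge_block mulr_ge0// invr_ge0 mulr_ge0// sqr_ge0.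
have n0 : (0 < #|'I_n|)%N by rewrite card_ord.
have E : \sum_j \sum_y \sum_(e | block_edge j e == Some y) edge_block e = 1.
  rewrite (eq_bigr (fun=> k%:R^-1)) => [|j _].
    by rewrite sumr_const card_ord -[LHS]mulr_natr mulVf.
  rewrite (eq_bigr _ (fun y _ => sum_edge_block_in j y)) -big_distrr/=.
  by rewrite (proj2 (prob_edge_unif n0)) mulr1.
rewrite -[RHS]E.
rewrite (eq_bigr (fun e => \sum_j \sum_y (if block_edge j e == Some y then edge_block e else 0))).
  under [RHS]eq_bigr do under eq_bigr do rewrite big_mkcond/=.
  under [RHS]eq_bigr do rewrite exchange_big/=.
  by rewrite exchange_big.
move=> e _; rewrite (bigD1 e.1.1)//= [X in _ = _ + X]big1 ?addr0 => [|j ne].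
  have [eb|eb] := eqVneq e.1.1 e.2.1.
    rewrite (bigD1 (e.1.2, e.2.2))//= /block_edge -eb !eqxx/= ?eqxx big1 ?addr0// => y ne.
    by case: eqP => // -[yE]; rewrite yE eqxx in ne.
  rewrite /edge_block (negPf eb) mul0r big1// => y _.
  by case: ifP.
rewrite big1// => y _; rewrite /block_edge.
by rewrite (eq_sym e.1.1) (negPf ne).
Qed.

(** Currying turns a colouring of [V] into independent colourings of the blocks, and each edge
    constrains only one of them. *)
Lemma Z_blocks (s : seq (V * V)) : all (fun e => e.1.1 == e.2.1) s ->
  Z s = \prod_(j < k) Z (pmap (block_edge j) s).
Proof.
move=> bs; rewrite /Z (bigA_distr_bigA (fun j (tau : {ffun 'I_n -> C}) =>
  colouring_weight w gam (pmap (block_edge j) s) tau)).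
pose cur (sigma : {ffun V -> C}) : {ffun 'I_k -> {ffun 'I_n -> C}} :=
  [ffun j => [ffun i => sigma (j, i)]].
rewrite [RHS](reindex cur)/=; last first.
  exists (fun t : {ffun 'I_k -> {ffun 'I_n -> C}} => [ffun v => t v.1 v.2]) => t _.
    by apply/ffunP => -[i j]; rewrite !ffunE.
  by apply/ffunP => i; apply/ffunP => j; rewrite !ffunE.
apply: eq_bigr => sigma _; rewrite /colouring_weight big_split/=; congr (_ * _).
  by rewrite pair_big/=; apply: eq_bigr => -[i j] _; rewrite !ffunE.
elim: s bs => [|[[j a] [j' b]] s IH] /=.
  by rewrite big_nil big1// => j _; rewrite big_nil.
move=> /andP[/eqP/= <- bs]; rewrite big_cons IH//.
have E1 : block_edge j (j, a, (j, b)) = Some (a, b) by rewrite /block_edge/= eqxx.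
have E2 i : i != j -> block_edge i (j, a, (j, b)) = None.
  by rewrite /block_edge/= eq_sym => /negPf ->.
rewrite (bigD1 j)//= [in RHS](bigD1 j)//= E1/= big_cons -!mulrA.
congr (_ * (_ * _)); first by rewrite /edge_weight !ffunE.
by apply: eq_bigr => i ij; rewrite E2.
Qed.

(** Replacing uniform edges by block edges lowers the mean, by [iid_mean_compare] and [lnZ_law_le].
    Under the block law [lnZ] is a sum over blocks, each receiving a binomial number of uniform
    edges with success probability [1/k]. *)
Lemma mean_lnZ_blocks m :
  k%:R * bin_mean k%:R^-1 m (mean_lnZ 'I_n) <= mean_lnZ V m.
Proof.
have V0 : (0 < #|{: V}|)%N by rewrite card_prod !card_ord muln_gt0 k_gt0.
have n0 : (0 < #|'I_n|)%N by rewrite card_ord.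
apply: (@le_trans _ _ (iid_mean edge_block m (@lnZ V))); last first.
  apply: iid_mean_compare => //.
  - exact: prob_edge_unif.
  - exact: prob_edge_block.
  - exact: lnZ_symmetric.
  move=> s; apply: (@lnZ_law_le _ _ _ _ c0) => //; first exact: edge_block_psd.
  by rewrite (proj2 prob_edge_block) (proj2 (prob_edge_unif V0)).
rewrite [leRHS](_ : _ = iid_mean edge_block m
   (fun s => \sum_(j < k) lnZ (pmap (block_edge j) s))).
  rewrite iid_mean_sum (eq_bigr (fun=> bin_mean k%:R^-1 m (mean_lnZ 'I_n))) => [|j _].
    by rewrite sumr_const card_ord mulr_natl.
  apply: iid_mean_pmap; first exact: (proj2 prob_edge_block).
    exact: (proj2 (prob_edge_unif n0)).
  exact: sum_edge_block_in.
(* Edges between different blocks have probability zero, so [Z_blocks] is needed only on the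
   support. *)
apply: eq_iid_mean_supp => s sb; rewrite /lnZ Z_blocks.
  by apply: ln_prod => j; exact: (@Z_gt0 _ _ _ _ c0).
apply: sub_all sb => e; apply: contraNT => /negPf ne.
by rewrite /edge_block ne mul0r.
Qed.

End Blocks.

End Superadditivity.

(** * Limit of the normalized means *)

(** Square root of a bound on the second moment of a block's edge count about its target:
    [c * n + c] for the variance and [(c + 1) ^+ 2] for the squared bias. *)
Definition deviation (R : realType) (c : R) (n : nat) : R :=
  Num.sqrt (c * n%:R + (c + (c + 1) ^+ 2)).

(** Cut the nodes into [k] blocks of size [n] and [s] leftover nodes. Since [s < n <= k], the mean
    edge count [M / k] of a block stays within [c + 1] of the target [m0], whatever [k] is. *)
Lemma mean_lnZ_superadditive (R : realType) (C : finType) (w gam : C -> R) (c0 : C)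
    (c : R) (n k s : nat) :
  (forall a, 0 <= w a) -> (forall a, 0 <= gam a <= 1) -> gam c0 = 0 -> 0 < w c0 ->
  0 < c -> (0 < n <= k)%N -> (s < n)%N ->
  k%:R * (mean_lnZ w gam 'I_n (Num.truncn (c * n%:R)) - lnZ_lip w c0 * deviation c n)
    + s%:R * ln (w c0)
  <= mean_lnZ w gam 'I_(k * n + s) (Num.truncn (c * (k * n + s)%:R)).
Proof.
move=> w0 g01 g0 wc0 c0' /andP[n0 nk] sn.
have k0 : (0 < k)%N by exact: leq_trans nk.
have kn0 : (0 < #|{: 'I_k * 'I_n}|)%N by rewrite card_prod !card_ord muln_gt0 k0.
set M := Num.truncn (c * (k * n + s)%:R); set m0 := Num.truncn (c * n%:R).
have -> : mean_lnZ w gam 'I_(k * n + s) M = mean_lnZ w gam ('I_k * 'I_n + 'I_s)%type M.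
  by apply: mean_lnZ_card; rewrite card_sum card_prod !card_ord.
have := @mean_lnZ_sum _ _ _ _ _ w0 g01 g0 wc0 ('I_k * 'I_n)%type 'I_s M kn0.
rewrite card_ord; apply: le_trans; rewrite lerD2r.
apply: le_trans (@mean_lnZ_blocks _ _ _ _ _ w0 g01 g0 wc0 _ _ k0 n0 M).
rewrite ler_pM2l ?ltr0n//.
set x := deviation c n.
have v0 : 0 < c * n%:R + (c + (c + 1) ^+ 2).
  by apply: ltr_wpDl; [rewrite mulr_ge0// ltW|]; have := sqr_ge0 (c + 1); lra.
have x0 : 0 < x by rewrite sqrtr_gt0.
have n0' : (0 < #|'I_n|)%N by rewrite card_ord.
have lip m := @mean_lnZ_lip _ _ _ _ _ w0 g01 g0 wc0 'I_n m n0'.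
have D0 : 0 <= lnZ_lip w c0.
  by have /andP[h1 h2] := lip 0%N; have := le_trans h1 h2; rewrite lerBlDr lerDl.
have kR : (0 : R) < k%:R by rewrite ltr0n.
have p01 : 0 <= (k%:R^-1 : R) <= 1.
  by apply/andP; split; [rewrite invr_ge0 ltW|rewrite invf_le1 ?ler1n].
have lipabs m : `|mean_lnZ w gam 'I_n m.+1 - mean_lnZ w gam 'I_n m| <= lnZ_lip w c0.
  by have /andP[] := lip m; rewrite ler_norml; lra.
apply: le_trans (@bin_mean_ge _ _ M (mean_lnZ w gam 'I_n) m0 _ x p01 x0 D0 lipabs).
rewrite lerD2l lerN2 -mulrA ler_wpM2l//.
have xx : x ^+ 2 = c * n%:R + (c + (c + 1) ^+ 2) by rewrite sqr_sqrtr// ltW.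
have /andP[M1 M2] : M%:R <= c * (k * n + s)%:R < M.+1%:R.
  by apply: truncn_itv; rewrite mulr_ge0// ltW.
have /andP[m1 m2] : m0%:R <= c * n%:R < m0.+1%:R.
  by apply: truncn_itv; rewrite mulr_ge0// ltW.
have Nk : c * (k * n + s)%:R / k%:R = c * n%:R + c * (s%:R / k%:R).
  by rewrite natrD natrM; field; rewrite gt_eqF.
have sk : s%:R / k%:R <= 1 :> R.
  by rewrite ler_pdivrMr// mul1r ler_nat (leq_trans (ltnW sn)).
have sk0 : 0 <= s%:R / k%:R :> R by rewrite divr_ge0.
have q1 : M%:R / k%:R <= c * n%:R + c.
  apply: (@le_trans _ _ (c * (k * n + s)%:R / k%:R)); first by rewrite ler_pM2r ?invr_gt0.
  by rewrite Nk lerD2l ger_pMr.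
have q2 : c * n%:R - 1 <= M%:R / k%:R.
  rewrite lerBlDr; apply: (@le_trans _ _ (c * (k * n + s)%:R / k%:R)).
    by rewrite Nk lerDl mulr_ge0// ltW.
  rewrite ler_pdivrMr// mulrDl mulfVK ?gt_eqF// mul1r.
  apply: (le_trans (ltW M2)); rewrite -natr1 lerD2l ler1n//.
have d2 : (M%:R / k%:R - m0%:R) ^+ 2 <= (c + 1) ^+ 2.
  rewrite -[leLHS]real_normK ?num_real// lerXn2r ?nnegrE//; first by lra.
  by rewrite ler_norml; move: m2; rewrite -natr1 => m2; apply/andP; split; lra.
(* The free parameter of [bin_mean_ge] is [x = deviation c n]: the second moment is at most
   [x ^+ 2], so the averaged penalty is at most [x]. *)
rewrite ler_pdivrMr// -lerBrDr.
have -> : x * 2 - x = x ^+ 2 / x by field; rewrite gt_eqF.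
by rewrite ler_pM2r ?invr_gt0// xx; lra.
Qed.

Lemma deviation_small (R : realType) (c e : R) : 0 < c -> 0 < e ->
  exists N : nat, forall n, (N < n)%N -> deviation c n <= e * n%:R.
Proof.
move=> c0 e0; set b := c + (c + 1) ^+ 2.
have b0 : 0 < b by rewrite /b; have := sqr_ge0 (c + 1); lra.
rewrite /deviation -/b; move: b b0 => b b0.
(* For [n >= 1] the radicand is at most [(c + b) * n], and beyond this threshold that is at most
   [(e * n) ^ 2]. *)
exists (Num.truncn ((c + b) / e ^+ 2)) => n Nn.
have n1 : 1 <= n%:R :> R by rewrite ler1n (leq_trans _ Nn).
have n0 : 0 < n%:R :> R by apply: lt_le_trans n1.
rewrite -[leRHS]ger0_norm ?mulr_ge0 ?(ltW e0)// -sqrtr_sqr ler_sqrt ?sqr_ge0//.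
have h : (c + b) / e ^+ 2 <= n%:R.
  apply: ltW; apply: (lt_le_trans (truncnS_gt _)); by rewrite ler_nat.
rewrite exprMn expr2 [n%:R ^+ 2]expr2 mulrA.
apply: (@le_trans _ _ ((c + b) * n%:R)).
  by rewrite (mulrDl c b) lerD2l ler_peMr// ltW.
by rewrite ler_pM2r// -expr2 mulrC -ler_pdivrMr ?exprn_gt0.
Qed.

(* The limit is the supremum of [a n / n - D * deviation c n / n]. *)
Lemma superadditive_limit (R : realType) (a : nat -> R) (c D lo hi : R) :
  0 < c -> 0 <= D ->
  (forall n, (0 < n)%N -> a n <= n%:R * hi) ->
  (forall n k s, (0 < n <= k)%N -> (s < n)%N ->
    k%:R * (a n - D * deviation c n) + s%:R * lo <= a (k * n + s)%N) ->
  exists z : R, forall eps, 0 < eps ->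
    exists N0 : nat, forall N, (N0 < N)%N -> `|a N / N%:R - z| <= eps.
Proof.
move=> c0 D0 ahi asup.
pose beta n := a n / n%:R - D * deviation c n / n%:R.
pose B : set R := [set beta n | n in [set n | (0 < n)%N]].
have dev0 n : 0 <= deviation c n by exact: sqrtr_ge0.
have Bub : has_ubound B.
  exists hi => _ [n/= n0 <-]; rewrite /beta.
  have nR : 0 < n%:R :> R by rewrite ltr0n.
  apply: (@le_trans _ _ (a n / n%:R)).
    by rewrite lerBlDr lerDl divr_ge0// mulr_ge0.
  by rewrite ler_pdivrMr// mulrC ahi.
have B0 : B !=set0 by exists (beta 1%N), 1%N.
exists (sup B) => eps eps0.
have e2 : 0 < eps / 2 by rewrite divr_gt0.
have [N1 HN1] : exists N : nat, forall n, (N < n)%N -> D * deviation c n / n%:R <= eps.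
  have [D00|Dn] := eqVneq D 0.
    by exists 0%N => n _; rewrite D00 !mul0r ltW.
  have Dp : 0 < D by rewrite lt_neqAle eq_sym Dn.
  have [N HN] := deviation_small c0 (divr_gt0 eps0 Dp).
  exists N => n Nn; have nR : 0 < n%:R :> R by rewrite ltr0n (leq_trans _ Nn).
  rewrite ler_pdivrMr// mulrC -ler_pdivlMr//.
  by apply: le_trans (HN _ Nn) _; rewrite mulrAC.
have [_ [n/= n0 <-] bn] := sup_adherent e2 (conj B0 Bub).
have nR : 0 < n%:R :> R by rewrite ltr0n.
pose N2 := Num.truncn (n%:R * `|lo - beta n| / (eps / 2)).
(* [N1] makes the deviation term small, [N2] absorbs the at most [n] leftover nodes, and [N > n * n]
   gives the required [n <= N %/ n]. *)
exists (maxn N1 (maxn N2 (n * n))) => N.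
rewrite !gtn_max => /andP[NN1 /andP[NN2 Nnn]].
have NR : 0 < N%:R :> R by rewrite ltr0n (leq_trans _ NN1).
have NE : N = (N %/ n * n + N %% n)%N by exact: divn_eq.
have sn : (N %% n < n)%N by rewrite ltn_mod.
have nk : (0 < n <= N %/ n)%N by rewrite n0 leq_divRL// ltnW.
have ub : a N / N%:R <= sup B + eps.
  have bN : beta N <= sup B.
    by apply: ub_le_sup => //; exists N => //=; rewrite (leq_trans _ NN1).
  by have := HN1 N NN1; move: bN; rewrite /beta; lra.
have lb : sup B - eps <= a N / N%:R.
  have H := asup n (N %/ n)%N (N %% n)%N nk sn; rewrite -NE in H.
  have E : (N %/ n)%:R * (a n - D * deviation c n) = (N%:R - (N %% n)%:R) * beta n.
    rewrite {2}NE natrD natrM addrK /beta; field.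
    by rewrite gt_eqF.
  rewrite E in H.
  have h2 : - (eps / 2 * N%:R) <= (N %% n)%:R * (lo - beta n).
    apply: (@le_trans _ _ (- (n%:R * `|lo - beta n|))).
      rewrite lerN2 [leRHS]mulrC -ler_pdivrMr//.
      by apply: ltW; apply: (lt_le_trans (truncnS_gt _)); rewrite ler_nat.
    rewrite -[leRHS]opprK lerN2 -mulrN.
    apply: (@le_trans _ _ ((N %% n)%:R * `|lo - beta n|)).
      by rewrite ler_wpM2l// -normrN ler_norm.
    by rewrite ler_wpM2r// ler_nat ltnW.
  rewrite ler_pdivlMr//.
  have bb : (sup B - eps / 2) * N%:R <= beta n * N%:R by rewrite ler_wpM2r// ltW.
  by move: H h2 bb; lra.
by rewrite ler_norml; apply/andP; split; move: ub lb; lra.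
Qed.

(** * Limits of means and the Chebyshev inequality *)

Section Limits.
Context {R : realType} {T : finType}.

Lemma cvg_iid_mean (mu : T -> R) n (f : nat -> seq T -> R) (g : seq T -> R) :
  (forall s, f K s @[K --> \oo] --> g s) ->
  iid_mean mu n (f K) @[K --> \oo] --> iid_mean mu n g.
Proof.
elim: n f g => [|n IH] f g fg /=; first exact: fg.
apply: cvg_big => [|x _]; first exact: add_continuous.
by apply: cvgMr; apply: (IH (fun K s => f K (x :: s))).
Qed.

Lemma iid_chebyshev (mu : T -> R) n (f : seq T -> R) (D t : R) :
  prob_law mu -> symmetric_fun f -> (forall x s, `|f (x :: s) - f s| <= D) -> 0 < t ->
  iid_mean mu n (fun s => (t < `|f s - iid_mean mu n f|)%R%:R) <= n%:R * D ^+ 2 / t ^+ 2.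
Proof.
move=> pmu sf fD t0; set m := iid_mean mu n f.
apply: (@le_trans _ _ (iid_mean mu n (fun s => (t ^+ 2)^-1 * (f s ^+ 2 + ((-2 * m) * f s + m ^+ 2))))).
  apply: le_iid_mean => // s _.
  have -> : f s ^+ 2 + (- 2 * m * f s + m ^+ 2) = `|f s - m| ^+ 2.
    by rewrite real_normK ?num_real//; ring.
  case: (ltP t) => h /=; last by rewrite mulr_ge0// ?invr_ge0 exprn_ge0// ltW.
  rewrite mulrC ler_pdivlMr ?exprn_gt0// mul1r lerXn2r ?nnegrE//; exact: ltW.
rewrite iid_meanZ !iid_meanD iid_meanZ iid_mean_cst// mulrC ler_pM2r ?invr_gt0 ?exprn_gt0//.
have := iid_variance n pmu sf fD; rewrite -/m.
set v := iid_mean _ _ _; rewrite expr2; lra.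
Qed.

End Limits.

(** * Integrals over product measures *)

Section TupleIntegral.
Context {d : measure_display} {T : measurableType d} {R : realType}.
Variable mu : {sigma_finite_measure set T -> \bar R}.

Lemma measurable_tnth_comp (n : nat) (u : 'I_n) (f : T -> R) :
  measurable_fun setT f -> measurable_fun setT (fun x : n.-tuple T => f (tnth x u)).
Proof. by move=> mf; apply: measurableT_comp => //; exact: measurable_tnth. Qed.

Lemma measurable_prod_tnth (n : nat) (f : 'I_n -> T -> R) :
  (forall u, measurable_fun setT (f u)) ->
  measurable_fun setT (fun x : n.-tuple T => \prod_(u < n) f u (tnth x u)).
Proof.
by move=> mf; apply: measurable_prod => u _; exact: measurable_tnth_comp.
Qed.

Lemma integral_prod_tnth (n : nat) (f : 'I_n -> T -> R) :
  (forall u, measurable_fun setT (f u)) -> (forall u x, 0 <= f u x) ->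
  (\int[tuple_measure mu n]_x (\prod_(u < n) f u (tnth x u))%:E =
   \prod_(u < n) \int[mu]_x (f u x)%:E)%E.
Proof.
elim: n f => [|n IH] f mf f0.
  rewrite big_ord0 /= integral_dirac//; first by rewrite diracT mul1e big_ord0.
  by apply/measurable_EFinP; exact: measurable_prod_tnth.
pose nu := tuple_measure mu n.
pose g (t : n.-tuple T) := \prod_(u < n) f (lift ord0 u) (tnth t u).
have mg : measurable_fun setT g.
  exact: (measurable_prod_tnth (fun u => mf (lift ord0 u))).
have g0 t : 0 <= g t by rewrite /g; apply: prodr_ge0 => u _; exact: f0.
have -> : (\int[tuple_measure mu n.+1]_x (\prod_(u < n.+1) f u (tnth x u))%:E =
    \int[pushforward (mu \x nu) (@tcons _ T n)]_x (\prod_(u < n.+1) f u (tnth x u))%:E)%E.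
  by [].
rewrite ge0_integral_pushforward//; first last.
- by move=> x _; rewrite lee_fin; apply: prodr_ge0 => u _; exact: f0.
- by apply/measurable_EFinP; exact: measurable_prod_tnth.
- exact: measurable_tcons.
rewrite preimage_setT.
have E z : (\prod_(u < n.+1) f u (tnth (tcons z) u))%:E = (f ord0 z.1 * g z.2)%:E.
  by congr EFin; rewrite big_ord_recl; congr (_ * _); apply: eq_bigr => u _; rewrite tnthS.
under eq_integral do rewrite /= E.
rewrite fubini_tonelli1//; first last.
- by move=> z; rewrite lee_fin mulr_ge0.
- apply/measurable_EFinP; apply: measurable_funM.
    by apply: measurableT_comp => //; exact: measurable_fst.
  by apply: measurableT_comp => //; exact: measurable_snd.
rewrite /fubini_F/=.
under eq_integral.
  move=> x _; under eq_integral do rewrite EFinM.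
  rewrite ge0_integralZl_EFin//; first over.
  - by move=> t _; rewrite lee_fin.
  - exact/measurable_EFinP.
rewrite ge0_integralZr//; first last.
- by apply: integral_ge0 => t _; rewrite lee_fin.
- by move=> x _; rewrite lee_fin.
- exact/measurable_EFinP.
by rewrite big_ord_recl -(IH (fun u => f (lift ord0 u))).
Qed.

(** Split the integrand according to the colouring of the tuple: at each point one term survives,
    and every term is a product over coordinates, integrated by [integral_prod_tnth]. *)
Lemma integral_coloured_tuple (n : nat) (C : finType) (col : T -> C) (h : T -> R)
    (w : C -> R) (Phi : {ffun 'I_n -> C} -> R) :
  measurable_fun setT h -> (forall x, 0 <= h x) ->
  (forall a, measurable (col @^-1` [set a])) ->
  (forall a, (\int[mu]_x (h x * (col x == a)%:R)%:E = (w a)%:E)%E) ->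
  (forall sigma, 0 <= Phi sigma) ->
  (\int[tuple_measure mu n]_x
     ((\prod_(u < n) h (tnth x u)) * Phi [ffun u => col (tnth x u)])%:E =
   (\sum_(sigma : {ffun 'I_n -> C}) (\prod_(u < n) w (sigma u)) * Phi sigma)%:E)%E.
Proof.
move=> mh h0 mcol wE Phi0.
have mind a : measurable_fun setT (fun x => (col x == a)%:R : R).
  rewrite (_ : (fun x => _) = \1_(col @^-1` [set a])).
    exact: measurable_indic.
  apply/funext => x; rewrite indicE; congr (_%:R); apply: congr1.
  by apply/eqP/idP => [E|]; [rewrite inE|rewrite inE].
have mhi a : measurable_fun setT (fun x => h x * (col x == a)%:R) by exact: measurable_funM.
have E x : ((\prod_(u < n) h (tnth x u)) * Phi [ffun u => col (tnth x u)])%:E =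
  (\sum_(sigma : {ffun 'I_n -> C})
     (Phi sigma)%:E * (\prod_(u < n) (h (tnth x u) * (col (tnth x u) == sigma u)%:R))%:E)%E.
  rewrite (bigD1 [ffun u => col (tnth x u)])//= [X in _ + X]big1 ?adde0 => [|sigma ne].
    rewrite -EFinM mulrC; congr EFin; congr (_ * _).
    by apply: eq_bigr => u _; rewrite ffunE eqxx mulr1.
  have [u /negPf hu] : exists u, col (tnth x u) != sigma u.
    apply/existsP; rewrite -negb_forall; apply: contra ne => /forallP H.
    by apply/eqP/ffunP => u; rewrite ffunE (eqP (H u)).
  by rewrite -EFinM (bigD1 u)//= hu mulr0 mul0r mulr0.
under eq_integral do rewrite E.
rewrite ge0_integral_sum//; first last.
- move=> sigma x _; rewrite -EFinM lee_fin mulr_ge0//.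
  by apply: prodr_ge0 => u _; rewrite mulr_ge0.
- move=> sigma; apply/measurable_EFinP.
  apply: measurable_funM => //; exact: (measurable_prod_tnth (fun u => mhi (sigma u))).
rewrite -sumEFin; apply: eq_bigr => sigma _.
rewrite ge0_integralZl_EFin//; first last.
- apply/measurable_EFinP; exact: (measurable_prod_tnth (fun u => mhi (sigma u))).
- by move=> x _; rewrite lee_fin; apply: prodr_ge0 => u _; rewrite mulr_ge0.
rewrite (@integral_prod_tnth n (fun u x => h x * (col x == sigma u)%:R))//; last first.
  by move=> u x; rewrite mulr_ge0.
under eq_bigr do rewrite wE.
by rewrite prodEFin -EFinM mulrC.
Qed.

End TupleIntegral.

Section ColourMass.
Context {d : measure_display} {T : measurableType d} {R : realType}.
Variable mu : {sigma_finite_measure set T -> \bar R}.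

Lemma ge0_le_integral_EFin (f g : T -> R) :
  measurable_fun setT f -> measurable_fun setT g -> (forall x, 0 <= f x <= g x) ->
  (\int[mu]_x (f x)%:E <= \int[mu]_x (g x)%:E)%E.
Proof.
move=> mf mg fg; apply: ge0_le_integral => //.
- by move=> x _; rewrite lee_fin; case/andP: (fg x).
- exact/measurable_EFinP.
- exact/measurable_EFinP.
- by move=> x _; rewrite lee_fin; case/andP: (fg x).
Qed.

Lemma ge0_integral_pushforward_EFin (d' : measure_display) (T' : measurableType d')
    (phi : T -> T') (f : T' -> R) :
  measurable_fun setT phi -> measurable_fun setT f -> (forall x, 0 <= f x) ->
  (\int[pushforward mu phi]_x (f x)%:E = \int[mu]_x (f (phi x))%:E)%E.
Proof.
move=> mphi mf f0; rewrite ge0_integral_pushforward//.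
- exact/measurable_EFinP.
- by move=> x _; rewrite lee_fin.
Qed.

Lemma integral_scale_indic (a : R) (B : set T) : 0 <= a -> measurable B ->
  (\int[mu]_x (a * \1_B x)%:E = a%:E * mu B)%E.
Proof.
move=> a0 mB; under eq_integral do rewrite EFinM.
rewrite ge0_integralZl_EFin//; last first.
  by apply/measurable_EFinP; exact: measurable_indic.
by rewrite integral_indic// setIT.
Qed.

Lemma measurable_class_ind (C : eqType) (col : T -> C) (a : C) :
  measurable (col @^-1` [set a]) -> measurable_fun setT (fun x => (col x == a)%:R : R).
Proof.
move=> ma; rewrite (_ : (fun x => _) = \1_(col @^-1` [set a])).
  exact: measurable_indic.
apply/funext => x; rewrite indicE; congr (_%:R); congr nat_of_bool.
by apply/eqP/idP => [E|]; rewrite inE.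
Qed.

Variable h : T -> R.
Hypotheses (mh : measurable_fun setT h) (h0 : forall x, 0 <= h x).
Hypothesis h_fin : (\int[mu]_x (h x)%:E < +oo)%E.

Definition colour_mass (C : finType) (col : T -> C) (a : C) : R :=
  fine (\int[mu]_x (h x * (col x == a)%:R)%:E)%E.

Section OneColouring.
Variables (C : finType) (col : T -> C).
Hypothesis mcol : forall a, measurable (col @^-1` [set a]).

Let mhc a : measurable_fun setT (fun x => h x * (col x == a)%:R).
Proof. by apply: measurable_funM => //; exact: measurable_class_ind. Qed.

Lemma colour_massE a :
  (\int[mu]_x (h x * (col x == a)%:R)%:E = (colour_mass col a)%:E)%E.
Proof.
rewrite fineK// ge0_fin_numE.
  apply: le_lt_trans h_fin; apply: ge0_le_integral_EFin => // x.
  by rewrite mulr_ge0//= ler_piMr// lern1 leq_b1.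
by apply: integral_ge0 => x _; rewrite lee_fin mulr_ge0.
Qed.

Lemma colour_mass_ge0 a : 0 <= colour_mass col a.
Proof. by apply/fine_ge0/integral_ge0 => x _; rewrite lee_fin mulr_ge0. Qed.

Lemma wsum_colour_mass : (wsum (colour_mass col))%:E = (\int[mu]_x (h x)%:E)%E.
Proof.
rewrite -sumEFin; under eq_bigr do rewrite -colour_massE.
rewrite -ge0_integral_sum//; first last.
- by move=> a x _; rewrite lee_fin mulr_ge0.
- by move=> a; apply/measurable_EFinP.
apply: eq_integral => x _; rewrite sumEFin; congr EFin.
rewrite -big_distrr/= (bigD1 (col x))//= eqxx big1 ?addr0 ?mulr1// => a.
by rewrite eq_sym => /negPf ->.
Qed.

End OneColouring.

(** Dominated convergence; the product of the [h] is integrable because its integral is a finite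
    power of the total mass. *)
Lemma cvg_integral_tuple (n : nat) (F : nat -> n.-tuple T -> R) (G : n.-tuple T -> R) :
  (forall K, measurable_fun setT (F K)) ->
  (forall K x, 0 <= F K x <= \prod_(u < n) h (tnth x u)) ->
  (forall x, F K x @[K --> \oo] --> G x) ->
  (\int[tuple_measure mu n]_x (F K x)%:E)%E @[K --> \oo] -->
  (\int[tuple_measure mu n]_x (G x)%:E)%E.
Proof.
move=> mF Fb FG.
pose H (x : n.-tuple T) := \prod_(u < n) h (tnth x u).
have mH : measurable_fun setT H by exact: (measurable_prod_tnth (fun=> mh)).
have [|||||//] := @dominated_convergence _ _ _ (tuple_measure mu n) setT measurableT
  (fun K => EFin \o F K) (EFin \o G) (EFin \o H).
- by move=> K; exact/measurable_EFinP.
- by apply/measurable_EFinP; apply: (@measurable_fun_cvg _ _ _ _ F).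
- by apply: aeW => x _ /=; apply: cvg_EFin; [exact: nearW|exact: FG].
- apply/integrableP; split; first exact/measurable_EFinP.
  have fin : (\int[tuple_measure mu n]_x (H x)%:E < +oo)%E.
    rewrite (@integral_prod_tnth _ _ _ mu n (fun=> h))//.
    have : (\int[mu]_x (h x)%:E)%E \is a fin_num.
      by rewrite ge0_fin_numE//; apply: integral_ge0 => x _; rewrite lee_fin.
    by move=> /fineK <-; rewrite prodEFin ltry.
  apply: le_lt_trans fin; rewrite le_eqVlt; apply/orP; left; apply/eqP.
  apply: eq_integral => x _ /=; rewrite ger0_norm//.
  exact: prodr_ge0.
- apply: aeW => x K _ /=; rewrite lee_fin.
  by have /andP[F0 FH] := Fb K x; rewrite ger0_norm.
Qed.

End ColourMass.

(** * Concentration in the limit of finitely many colours *)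

Section LimitModel.
Context {R : realType}.
Variables (C : nat -> finType) (w gam : forall i, C i -> R) (c0 : forall i, C i).
Variables (w0 W : R) (L : forall N, seq ('I_N * 'I_N) -> R).
Arguments w : clear implicits.
Arguments gam : clear implicits.
Hypotheses (w_ge0 : forall i a, 0 <= w i a) (gam01 : forall i a, 0 <= gam i a <= 1).
Hypotheses (gam0 : forall i, gam i (c0 i) = 0) (wc0 : forall i, w i (c0 i) = w0).
Hypotheses (w0_gt0 : 0 < w0) (wsumE : forall i, wsum (w i) = W).
Hypothesis lnZ_cvg : forall N (s : seq ('I_N * 'I_N)),
  lnZ (w i) (gam i) s @[i --> \oo] --> L s.

Arguments w_ge0 : clear implicits.
Arguments gam01 : clear implicits.

(** As [w0] and [W] do not vary with [i], one Lipschitz constant serves all the models and hence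
    their limit [L]. *)
Let D := - ln (w0 / W).

Let wc0_gt0 i : 0 < w i (c0 i). Proof. by rewrite wc0. Qed.

Let lipE i : lnZ_lip (w i) (c0 i) = D.
Proof. by rewrite /lnZ_lip wc0 wsumE. Qed.

Lemma cvgn_ge (u : nat -> R) l a : u i @[i --> \oo] --> l -> (forall i, a <= u i) -> a <= l.
Proof.
move=> ul ua; rewrite -(cvg_lim (@Rhausdorff R) ul); apply: limr_ge.
  by apply/cvg_ex; exists l.
exact: nearW.
Qed.

Lemma cvgn_le (u v : nat -> R) l m : u i @[i --> \oo] --> l -> v i @[i --> \oo] --> m ->
  (forall i, u i <= v i) -> l <= m.
Proof.
move=> ul vm uv; rewrite -subr_ge0.
apply: (@cvgn_ge (fun i => v i - u i)); first exact: cvgB.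
by move=> i; rewrite subr_ge0.
Qed.

Lemma L_symmetric N : symmetric_fun (@L N).
Proof.
move=> s t st; apply: (cvg_unique (@Rhausdorff R) (@lnZ_cvg _ s)).
rewrite (_ : (fun i => lnZ _ _ s) = fun i => lnZ (w i) (gam i) t).
  exact: (@lnZ_cvg _ t).
by apply/funext => i; exact: lnZ_symmetric.
Qed.

Lemma L_lip N e (s : seq ('I_N * 'I_N)) : `|L (e :: s) - L s| <= D.
Proof.
have lip i := @lnZ_cons _ _ _ _ (c0 i) (w_ge0 i) (gam01 i) (gam0 i) (wc0_gt0 i) _ e s.
have c1 : (lnZ (w i) (gam i) (e :: s) - lnZ (w i) (gam i) s) @[i --> \oo] --> L (e :: s) - L s.
  exact: cvgB (@lnZ_cvg _ (e :: s)) (@lnZ_cvg _ s).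
have h1 : - D <= L (e :: s) - L s.
  apply: (cvgn_ge c1) => i /=; rewrite -(lipE i) lerBrDr addrC.
  by case/andP: (lip i).
have h2 : L (e :: s) - L s <= 0.
  rewrite subr_le0; apply: (cvgn_le (@lnZ_cvg _ (e :: s)) (@lnZ_cvg _ s)) => i.
  by case/andP: (lip i).
have D0 : 0 <= D by lra.
by rewrite ler_norml h1 (le_trans h2).
Qed.

Let D_ge0 : 0 <= D.
Proof. by apply: le_trans (@L_lip 1 (ord0, ord0) [::]). Qed.

Let W_gt0 : 0 < W.
Proof. by rewrite -(wsumE 0); apply: (@wsum_gt0 _ _ _ (c0 0%N)). Qed.

Lemma L_le N (s : seq ('I_N * 'I_N)) : L s <= N%:R * ln W.
Proof.
apply: (cvgn_le (@lnZ_cvg _ s) (cvg_cst _)) => i.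
rewrite /lnZ mulr_natl -lnXn// ler_ln ?posrE ?exprn_gt0//.
  by rewrite -(wsumE i) -{2}[N]card_ord Z_le.
exact: (@Z_gt0 _ _ _ _ (c0 i)).
Qed.

Definition mean_L N M := iid_mean (@edge_unif R 'I_N) M (@L N).

(** Near superadditivity has constants independent of [i], so it survives the limit in [i] at fixed
    sizes; only afterwards does [N] grow. *)
Lemma mean_L_limit (c : R) : 0 < c -> exists z : R, forall eps, 0 < eps ->
  exists N0 : nat, forall N, (N0 < N)%N ->
    `|mean_L N (Num.truncn (c * N%:R)) / N%:R - z| <= eps.
Proof.
move=> cp.
apply: (@superadditive_limit _ (fun N => mean_L N (Num.truncn (c * N%:R))) c D
  (ln w0) (ln W)) => // [N N0|n k s nk sn].
  have pU : prob_law (@edge_unif R 'I_N) by apply: prob_edge_unif; rewrite card_ord.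
  rewrite /mean_L -[leRHS](iid_mean_cst (Num.truncn (c * N%:R)) _ pU).
  by apply: le_iid_mean => // s _; exact: L_le.
have cv N M : mean_lnZ (w i) (gam i) 'I_N M @[i --> \oo] --> mean_L N M.
  by apply: cvg_iid_mean => t; exact: (@lnZ_cvg _ t).
apply: (cvgn_le _ (cv _ _)); last first.
  move=> i; have := @mean_lnZ_superadditive _ _ _ _ (c0 i) c n k s
    (w_ge0 i) (gam01 i) (gam0 i) (wc0_gt0 i) cp nk sn.
  by rewrite lipE wc0; apply: le_trans; exact: lexx.
apply: cvgD; last exact: cvg_cst.
apply: cvgMr; apply: cvgB; [exact: cv|exact: cvg_cst].
Qed.

Lemma deviation_prob_cvg0 (c : R) : 0 < c -> exists z : R, forall eps, 0 < eps ->
  iid_mean (@edge_unif R 'I_N) (Num.truncn (c * N%:R))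
    (fun s => (eps < `|N%:R^-1 * L s - z|)%R%:R) @[N --> \oo] --> (0 : R).
Proof.
move=> cp; have [z Hz] := mean_L_limit cp; exists z => eps eps0.
have e2 : 0 < eps / 2 by rewrite divr_gt0.
have [N0 HN0] := Hz _ e2.
(* At most [c * N] edges give variance at most [c * N * D ^+ 2]; Chebyshev at distance [eps / 2 * N]
   then yields [B / N]. The other [eps / 2] covers the distance from the normalized mean to [z]. *)
pose B := c * D ^+ 2 / (eps / 2) ^+ 2.
have B0 : 0 <= B by rewrite divr_ge0 ?exprn_ge0// ?(ltW e2)// mulr_ge0 ?exprn_ge0// ltW.
pose P N := iid_mean (@edge_unif R 'I_N) (Num.truncn (c * N%:R))
    (fun s => (eps < `|N%:R^-1 * L s - z|)%R%:R).
have Pb N : (N0 < N)%N -> 0 <= P N <= B * N%:R^-1.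
  move=> NN0; have NN : (0 < N)%N by rewrite (leq_trans _ NN0).
  have NR : 0 < N%:R :> R by rewrite ltr0n.
  have pU : prob_law (@edge_unif R 'I_N) by apply: prob_edge_unif; rewrite card_ord.
  apply/andP; split.
    by rewrite -[leLHS](iid_mean_cst (Num.truncn (c * N%:R)) 0 pU); apply: le_iid_mean.
  have t0 : 0 < eps / 2 * N%:R by rewrite mulr_gt0.
  have := iid_chebyshev (Num.truncn (c * N%:R)) pU (@L_symmetric N) (@L_lip N) t0.
  rewrite -/(mean_L N _) => cheb.
  have le1 : P N <= iid_mean (@edge_unif R 'I_N) (Num.truncn (c * N%:R))
      (fun s => (eps / 2 * N%:R < `|L s - mean_L N (Num.truncn (c * N%:R))|)%R%:R).
    apply: le_iid_mean => // s _; rewrite ler_nat.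
    case: (ltP eps) => //= h; rewrite lt0b ltNge; apply/negP => h2.
    have := HN0 N NN0; set m := mean_L _ _ in h2 * => h3.
    have h4 : `|N%:R^-1 * L s - m / N%:R| <= eps / 2.
      rewrite mulrC -mulrBl normrM (ger0_norm (x := N%:R^-1)) ?invr_ge0 ?(ltW NR)//.
      by rewrite ler_pdivrMr.
    by have := ler_distD (m / N%:R) (N%:R^-1 * L s) z; move: h h3 h4; lra.
  apply: (le_trans le1); apply: (le_trans cheb).
  apply: (@le_trans _ _ (c * N%:R * D ^+ 2 / (eps / 2 * N%:R) ^+ 2)).
    rewrite ler_pM2r ?invr_gt0 ?exprn_gt0// ler_wpM2r ?sqr_ge0//.
    by rewrite truncn_le// mulr_ge0// ltW.
  rewrite /B le_eqVlt; apply/orP; left; apply/eqP; field.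
  by rewrite !gt_eqF.
move: B B0 Pb => B B0 Pb; apply/cvgrPdist_le => e e0; near=> N.
have /Pb/andP[p0 p1] : (N0 < N)%N by near: N; exact: nbhs_infty_gt.
rewrite sub0r normrN ger0_norm//; apply: (le_trans p1).
have : B / e <= N%:R by near: N; exact: nbhs_infty_ger.
have NR : 0 < N%:R :> R by rewrite ltr0n; near: N; exact: nbhs_infty_gt.
by rewrite !ler_pdivrMr// mulrC.
Unshelve. all: by end_near. Qed.

End LimitModel.

(** Links the graph law to the recursive mean: [glue] attaches the edge of index 0 to a family of
    [M] edges. *)
Lemma sum_ffun_iid_mean (R : realType) (T : finType) (mu : T -> R) M (F : seq T -> R) :
  \sum_(g : {ffun 'I_M -> T}) (\prod_(e < M) mu (g e)) * F [seq g e | e <- enum 'I_M]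
  = iid_mean mu M F.
Proof.
elim: M F => [|M IH] F /=.
  rewrite (bigD1 (ffun0 (card_ord 0)))//= big_ord0 mul1r.
  rewrite [X in map _ X](_ : _ = [::]) ?big1 ?addr0//; last by apply: size0nil; rewrite size_enum_ord.
  by move=> g /negP[]; apply/eqP/ffunP => -[].
pose glue (p : T * {ffun 'I_M -> T}) : {ffun 'I_M.+1 -> T} :=
  [ffun i => if unlift ord0 i is Some j then p.2 j else p.1].
have glueS p j : glue p (lift ord0 j) = p.2 j by rewrite ffunE liftK.
have glue0 p : glue p ord0 = p.1 by rewrite ffunE unlift_none.
rewrite (reindex glue)/=; last first.
  exists (fun g => (g ord0, [ffun j => g (lift ord0 j)])) => [[x g] _|g _].
    by congr pair; [rewrite glue0|apply/ffunP => j; rewrite ffunE glueS].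
  by apply/ffunP => i; rewrite ffunE; case: unliftP => [j ->|->]/=; rewrite ?ffunE.
rewrite -(pair_bigA _ (fun x g => (\prod_(e < M.+1) mu (glue (x, g) e)) *
  F [seq glue (x, g) e | e <- enum 'I_M.+1]))/=.
apply: eq_bigr => x _; rewrite -IH big_distrr/=; apply: eq_bigr => g _.
rewrite big_ord_recl glue0 -mulrA; congr (_ * (_ * F _)).
  by apply: eq_bigr => e _; rewrite glueS.
rewrite enum_ordSl/= glue0 -map_comp; congr (_ :: _).
by apply: eq_map => e /=; rewrite glueS.
Qed.

(** * Truncation of the hard classes *)

Section Truncation.
Context {d : measure_display} {T : measurableType d} {R : realType}.
Variable mu : {sigma_finite_measure set T -> \bar R}.
Variables (A : nat -> set T) (gamma : nat -> R) (h : T -> R) (r0 : nat).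
Hypotheses (mA : forall r, measurable (A r)) (tA : trivIset [set: nat] A).
Hypotheses (gamma01 : forall r, gamma r = 0 \/ gamma r = 1) (gamma_r0 : gamma r0 = 0).
Hypotheses (mh : measurable_fun setT h) (h0 : forall x, 0 <= h x).
Hypothesis h_fin : (\int[mu]_x (h x)%:E < +oo)%E.
Hypothesis h_r0 : (0 < \int[mu]_x (h x * (x \in A r0)%:R)%:E)%E.

(* The classes of index at least [K] are merged into the free colour [K]. *)
Definition colour K (x : T) : 'I_K.+1 :=
  if [pick r : 'I_K | x \in A r] is Some r then widen_ord (leqnSn K) r else ord_max.

Definition colour_gamma K (a : 'I_K.+1) : R := if (a < K)%N then gamma a else 0.

Definition hard_core_potential (x y : T) : R :=
  1 - limn [series gamma r * \1_(A r `*` A r) (x, y)]_r.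

Definition trunc_potential K (x y : T) : R :=
  1 - series (fun r => gamma r * \1_(A r `*` A r) (x, y)) K.

Lemma A_inj r r' x : A r x -> A r' x -> r = r'.
Proof.
move=> rx r'x; apply/eqP; apply: contraT => ne.
move/trivIsetP : tA => /(_ _ _ I I ne) E.
by have : (A r `&` A r') x by []; rewrite E.
Qed.

Lemma colour_ltP K (a : 'I_K.+1) x : (a < K)%N -> (colour K x == a) = (x \in A a).
Proof.
move=> aK; rewrite /colour; case: pickP => [r xr|none].
  apply/eqP/idP => [<-//|xa]; apply/val_inj/(@A_inj _ _ x); first by rewrite inE in xr.
  by rewrite inE in xa.
rewrite (none (Ordinal aK)); apply/eqP => E.
by move: aK; rewrite -E ltnn.
Qed.

(** By disjointness only the class of [x] can contribute to the partial sum, so the truncated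
    potential depends on colours alone. *)
Lemma trunc_potentialE K x y : trunc_potential K x y =
  1 - colour_gamma (colour K x) * (colour K x == colour K y)%:R.
Proof.
rewrite /trunc_potential; congr (_ - _); rewrite /series/= big_mkord.
have ind (r : 'I_K) : \1_(A r `*` A r) (x, y) =
    (colour K x == widen_ord (leqnSn K) r)%:R * (colour K y == widen_ord (leqnSn K) r)%:R :> R.
  rewrite !colour_ltP//= indicE -natrM mulnb; congr (_%:R); congr nat_of_bool.
  by apply/idP/andP; rewrite !inE.
under eq_bigr do rewrite ind.
rewrite /colour_gamma; case: ltnP => [aK|Ka].
  rewrite (bigD1 (Ordinal aK))//= big1 ?addr0 => [|r ne].
    have -> : widen_ord (leqnSn K) (Ordinal aK) = colour K x by apply/val_inj.
    by rewrite eqxx mul1r (eq_sym (colour K y)).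
  have /negPf -> : colour K x != widen_ord (leqnSn K) r.
    by apply: contra ne => /eqP E; apply/eqP/val_inj; rewrite /= E.
  by rewrite mul0r mulr0.
rewrite big1 ?mul0r// => r _.
have /negPf -> : colour K x != widen_ord (leqnSn K) r.
  by apply/eqP => E; move: Ka; rewrite E/= leqNgt ltn_ord.
by rewrite mul0r mulr0.
Qed.

Lemma colour_gamma01 K (a : 'I_K.+1) : 0 <= colour_gamma a <= 1.
Proof.
rewrite /colour_gamma; case: ifP => _; last by rewrite lexx ler01.
by case: (gamma01 a) => ->; rewrite ?lexx ?ler01.
Qed.

Lemma trunc_potential01 K x y : 0 <= trunc_potential K x y <= 1.
Proof.
rewrite trunc_potentialE; have /andP[g0 g1] := colour_gamma01 (colour K x).
by case: (_ == _); rewrite ?mulr1 ?mulr0 ?subr0 ?ler01 ?lexx// subr_ge0 g1 lerBlDr lerDl.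
Qed.

(** The partial sums are nondecreasing and at most 1, so [limn] is a genuine limit here and not a
    default value. *)
Lemma trunc_potential_cvg x y :
  trunc_potential K x y @[K --> \oo] --> hard_core_potential x y.
Proof.
pose u r : R := gamma r * \1_(A r `*` A r) (x, y).
have u0 r : 0 <= u r.
  by apply: mulr_ge0; [case: (gamma01 r) => ->|rewrite indicE].
suff cu : cvgn (series u) by apply: cvgB; [exact: cvg_cst|exact: cu].
apply: nondecreasing_is_cvgn; first exact: nondecreasing_series.
exists 1 => _ [K _ <-].
by have /andP[+ _] := trunc_potential01 K x y; rewrite /trunc_potential subr_ge0.
Qed.

Lemma measurable_colour K (a : 'I_K.+1) : measurable (@colour K @^-1` [set a]).
Proof.
have small (b : 'I_K.+1) : (b < K)%N -> measurable (@colour K @^-1` [set b]).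
  move=> bK; rewrite (_ : _ @^-1` _ = A b); first exact: mA.
  apply/seteqP; split=> x /=.
    by move=> /eqP; rewrite colour_ltP// inE.
  by move=> xb; apply/eqP; rewrite colour_ltP// inE.
have [aK|Ka] := ltnP a K; first exact: small.
rewrite (_ : _ @^-1` _ =
    ~` (\bigcup_(b in [set b : 'I_K.+1 | (b < K)%N]) (@colour K @^-1` [set b]))).
  by apply: measurableC; apply: fin_bigcup_measurable => // b; exact: small.
apply/seteqP; split=> x /=.
  by move=> E [b /= bK Eb]; move: bK; rewrite -Eb E ltnNge Ka.
move=> nE; apply/val_inj/eqP; rewrite eqn_leq.
have aE : val a = K by apply/eqP; rewrite eqn_leq Ka -ltnS ltn_ord.
rewrite aE -ltnS ltn_ord/= leqNgt; apply/negP => lK; apply: nE.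
by exists (colour K x).
Qed.

Lemma measurable_trunc_potential K N (u v : 'I_N) :
  measurable_fun setT (fun x : N.-tuple T => trunc_potential K (tnth x u) (tnth x v)).
Proof.
have ind w a : measurable_fun setT (fun x : N.-tuple T => (colour K (tnth x w) == a)%:R : R).
  apply: (@measurable_tnth_comp _ _ _ _ _ (fun x => (colour K x == a)%:R)).
  by apply: measurable_class_ind; exact: measurable_colour.
rewrite (_ : (fun x => _) = fun x : N.-tuple T => 1 - \sum_(a : 'I_K.+1)
    colour_gamma a * ((colour K (tnth x u) == a)%:R * (colour K (tnth x v) == a)%:R)).
  apply: measurable_funB => //; apply: measurable_sum => a.
  by apply: measurable_funM => //; exact: measurable_funM.
apply/funext => x; rewrite trunc_potentialE; congr (_ - _).
rewrite (bigD1 (colour K (tnth x u)))//= eqxx mul1r big1 ?addr0 => [|a].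
  by rewrite eq_sym.
by rewrite eq_sym => /negPf ->; rewrite mul0r mulr0.
Qed.

Definition potential_integral (J : T -> T -> R) N (s : seq ('I_N * 'I_N)) : \bar R :=
  (\int[tuple_measure mu N]_x ((\prod_(u < N) h (tnth x u)) *
    \prod_(e <- s) J (tnth x e.1) (tnth x e.2))%:E)%E.

Local Notation w K := (colour_mass mu h (@colour K)).

Lemma Z_potential_integral K N (s : seq ('I_N * 'I_N)) :
  (partition_sum (w K) (@colour_gamma K) s)%:E = potential_integral (trunc_potential K) s.
Proof.
rewrite /potential_integral -(@integral_coloured_tuple _ _ _ mu N 'I_K.+1 (@colour K) h (w K)
  (fun sigma => \prod_(e <- s) edge_weight (@colour_gamma K) sigma e)) => //.
- apply: eq_integral => x _; congr (_ * _)%:E.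
  by apply: eq_bigr => e _; rewrite trunc_potentialE /edge_weight !ffunE.
- exact: measurable_colour.
- by move=> a; apply: colour_massE => //; exact: measurable_colour.
- by move=> sigma; case/andP: (prod_edge_weight01 (@colour_gamma01 K) s sigma).
Qed.

Lemma potential_integral_cvg N (s : seq ('I_N * 'I_N)) :
  (partition_sum (w K) (@colour_gamma K) s)%:E @[K --> \oo] --> potential_integral hard_core_potential s.
Proof.
under eq_fun do rewrite Z_potential_integral.
have p01 K (x : N.-tuple T) :
    0 <= \prod_(e <- s) trunc_potential K (tnth x e.1) (tnth x e.2) <= 1.
  elim: s => [|e s' /andP[IH0 IH1]]; first by rewrite big_nil ler01 lexx.
  rewrite big_cons; have /andP[e0 e1] := trunc_potential01 K (tnth x e.1) (tnth x e.2).
  by rewrite mulr_ge0// mulr_ile1.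
have H0 (x : N.-tuple T) : 0 <= \prod_(u < N) h (tnth x u) by apply: prodr_ge0.
apply: (@cvg_integral_tuple _ _ _ mu h mh h0 h_fin) => [K|K x|x].
- apply: measurable_funM; first exact: (measurable_prod_tnth (fun=> mh)).
  by apply: measurable_prod => e _; exact: measurable_trunc_potential.
- by have /andP[q0 q1] := p01 K x; rewrite mulr_ge0//= ler_piMr.
apply: cvgMr; apply: cvg_big => [|e _]; first exact: mul_continuous.
exact: trunc_potential_cvg.
Qed.

Local Notation W := (fine (\int[mu]_x (h x)%:E)%E).
Local Notation w0 := (fine (\int[mu]_x (h x * (x \in A r0)%:R)%:E)%E).

(** Truncating at [i + r0.+1] keeps [r0] below the cut-off, so the free class [A r0] remains a
    colour of its own and its mass is the same for all [i]. *)
Let c0 i : 'I_(i + r0.+1).+1 := inord r0.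

Let c0E i : c0 i = r0 :> nat.
Proof. by rewrite /c0 inordK// ltnS (leq_trans (leqnSn _) (leq_addl _ _)). Qed.

Lemma colour_mass_c0 i : w (i + r0.+1)%N (c0 i) = w0.
Proof.
congr fine; apply: eq_integral => x _.
by rewrite colour_ltP c0E// ltn_addl.
Qed.

Lemma w0_gt0 : 0 < w0.
Proof.
rewrite -(colour_mass_c0 0) -lte_fin -colour_massE//; last exact: measurable_colour.
rewrite (eq_integral (fun x => (h x * (x \in A r0)%:R)%:E))// => x _.
by rewrite colour_ltP c0E// ltn_addl.
Qed.

Lemma hard_core_deviation (c : R) : 0 < c ->
  (forall N (s : seq ('I_N * 'I_N)), exists2 y : R, 0 < y &
    potential_integral hard_core_potential s = y%:E) /\
  exists z : R, forall eps, 0 < eps ->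
  iid_mean (@edge_unif R 'I_N) (Num.truncn (c * N%:R)) (fun s =>
    (eps < `|N%:R^-1 * ln (fine (potential_integral hard_core_potential s)) - z|)%R%:R)
  @[N --> \oo] --> (0 : R).
Proof.
move=> cp.
pose K i := (i + r0.+1)%N.
have cv N (s : seq ('I_N * 'I_N)) :
    (partition_sum (w (K i)) (@colour_gamma (K i)) s)%:E @[i --> \oo] -->
    potential_integral hard_core_potential s.
  exact: (cvg_comp K _ (cvg_addnr r0.+1) (@potential_integral_cvg N s)).
have w_ge0 i (a : 'I_(K i).+1) : 0 <= w (K i) a by exact: colour_mass_ge0.
have g01 i (a : 'I_(K i).+1) : 0 <= colour_gamma a <= 1 by exact: colour_gamma01.
have g0 i : colour_gamma (c0 i) = 0 by rewrite /colour_gamma c0E gamma_r0 if_same.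
have wc0 i : 0 < w (K i) (c0 i) by rewrite colour_mass_c0 w0_gt0.
have wsumE i : wsum (w (K i)) = W.
  apply: EFin_inj; rewrite wsum_colour_mass//; last exact: measurable_colour.
  by rewrite fineK// ge0_fin_numE//; apply: integral_ge0 => x _; rewrite lee_fin.
(* The truncated sums lie between [w0 ^+ N] and [W ^+ N] uniformly, so the limit is positive and
   finite, where [ln] is continuous. *)
have fin N (s : seq ('I_N * 'I_N)) : exists2 y : R, 0 < y &
    potential_integral hard_core_potential s = y%:E.
  have lo : ((w0 ^+ N)%:E <= potential_integral hard_core_potential s)%E.
    rewrite -(cvg_lim _ (cv N s))//; apply: lime_ge; first by apply/cvg_ex; eexists; exact: cv.
    apply: nearW => i; rewrite lee_fin -(colour_mass_c0 i) -{1}[N]card_ord.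
    exact: (Z_ge (w_ge0 i) (g01 i) (g0 i)).
  have hi : (potential_integral hard_core_potential s <= (W ^+ N)%:E)%E.
    rewrite -(cvg_lim _ (cv N s))//; apply: lime_le; first by apply/cvg_ex; eexists; exact: cv.
    apply: nearW => i; rewrite lee_fin -(wsumE i) -{2}[N]card_ord.
    exact: (Z_le (w_ge0 i) (g01 i)).
  move: lo hi; case: (potential_integral _ _) => // y.
  rewrite !lee_fin => lo _; exists y => //.
  by apply: lt_le_trans lo; rewrite exprn_gt0// w0_gt0.
split=> //.
apply: (@deviation_prob_cvg0 R (fun i => 'I_(K i).+1) (fun i => w (K i))
  (fun i => @colour_gamma (K i)) c0 w0 W
  (fun N s => ln (fine (potential_integral hard_core_potential s)))) => //.
- by move=> i; exact: colour_mass_c0.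
- exact: w0_gt0.
move=> N s; have [y y0 yE] := fin N s.
have cy : partition_sum (w (K i)) (@colour_gamma (K i)) s @[i --> \oo] --> y.
  have := cv N s; rewrite yE => /fine_cvg; apply.
rewrite yE/=; apply: (cvg_comp _ _ cy); exact: continuous_ln.
Qed.

End Truncation.

(** * The Gaussian node potential *)

Section Gaussian.
Context {R : realType}.
Local Notation h := (@gaussian_potential R).
Local Notation mu := (@completed_lebesgue_measure R).

Lemma gaussian_gt0 x : 0 < h x.
Proof. exact: expR_gt0. Qed.

Lemma measurable_borel_lebesgueR (f : R -> R) :
  measurable_fun [set: measurableTypeR R] (f : measurableTypeR R -> R) ->
  measurable_fun [set: lebesgueR R] (f : lebesgueR R -> R).
Proof.
move=> mf _ B mB; apply: sub_caratheodory.
exact: (mf measurableT B mB).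
Qed.

Lemma measurable_gaussian : measurable_fun [set: lebesgueR R] (h : lebesgueR R -> R).
Proof. exact: (measurable_borel_lebesgueR measurable_gauss_fun). Qed.

Lemma measurable_id_lebesgueR :
  measurable_fun [set: lebesgueR R] (id : lebesgueR R -> measurableTypeR R).
Proof. by move=> _ B mB; rewrite setTI preimage_id; exact: sub_caratheodory. Qed.

(** Pushing the completed measure forward along the identity to the Borel sets gives the usual
    Lebesgue measure, for which the Gaussian integral is known. *)
Lemma integral_gaussian_lty : (\int[mu]_x (h x)%:E < +oo)%E.
Proof.
have E := @ge0_integral_pushforward_EFin _ (lebesgueR R) R mu _ (measurableTypeR R) id h
  measurable_id_lebesgueR measurable_gauss_fun (fun x => ltW (gaussian_gt0 x)).
apply: (@le_lt_trans _ _ (\int[pushforward mu (id : lebesgueR R -> measurableTypeR R)]_x (h x)%:E)%E).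
  by rewrite E.
have -> : (\int[pushforward mu (id : lebesgueR R -> measurableTypeR R)]_x (h x)%:E =
   \int[@lebesgue_measure R]_x (gauss_fun x)%:E)%E by [].
by rewrite integralT_gauss ltry.
Qed.

Lemma measurable_mem_lebesgueR (B : set R) : lebesgue_measurable B ->
  measurable_fun [set: lebesgueR R] (fun x : lebesgueR R => (x \in B)%:R : R).
Proof.
move=> mB.
exact: (@measurable_indic _ (lebesgueR R) R setT B mB).
Qed.

Lemma integral_gaussian_gt0 (B : set R) (kappa : R) :
  lebesgue_measurable B -> 0 < kappa -> `[0, kappa[ `<=` B ->
  (0 < \int[mu]_x (h x * (x \in B)%:R)%:E)%E.
Proof.
move=> mB k0 kB; pose I : set R := `[0, kappa[%classic.
have mI : lebesgue_measurable I.
  apply: sub_caratheodory; exact: (@measurable_itv R (Interval (BLeft 0) (BLeft kappa))).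
(* A lower bound of the Gaussian on [[0, kappa)], so the integral is at least [e * kappa]. *)
pose e := expR (- kappa ^+ 2).
have := @ge0_le_integral_EFin _ (lebesgueR R) R mu (fun x => e * \1_I x)
  (fun x => h x * (x \in B)%:R)
  (measurable_funM (measurable_cst _) (measurable_mem_lebesgueR mI))
  (measurable_funM measurable_gaussian (measurable_mem_lebesgueR mB)).
rewrite (@integral_scale_indic _ (lebesgueR R) R mu e I (expR_ge0 _) mI).
set m := (X in (_ * X <= _)%E); have -> : m = kappa%:E.
  rewrite -[LHS]/(@lebesgue_measure R I) lebesgue_measure_itv/= lte_fin k0.
  by rewrite -EFinB subr0.
move=> H; apply: lt_le_trans (H _); first by rewrite -EFinM lte_fin mulr_gt0// expR_gt0.
move=> x; rewrite indicE mulr_ge0 ?expR_ge0//=.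
have [xI|_] := boolP (x \in I); last by rewrite mulr0 mulr_ge0// ltW// gaussian_gt0.
have -> : x \in B by move: xI; rewrite !inE; exact: kB.
move: xI; rewrite inE /I/= in_itv/= => /andP[x0 xk].
rewrite !mulr1 /e /gaussian_potential ler_expR lerN2 lerXn2r ?nnegrE ?(ltW xk)//.
exact: ltW.
Qed.

End Gaussian.

Theorem corollary1 (R : realType) (A : nat -> set R) (gamma : nat -> R)
    (mA : forall r, lebesgue_measurable (A r))
    (tA : trivIset [set: nat] A)
    (gamma01 : forall r, gamma r = 0 \/ gamma r = 1)
    (soft : exists r0 (kappa : R),
        [/\ 0 < kappa, gamma r0 = 0 & `[0, kappa[ `<=` A r0])
    (c : R) (c_gt0 : 0 < c) :
  right_converging (@gaussian_potential R) (block_potential gamma A) c.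
Proof.
have [r0 [kappa [kappa0 gr0 kA]]] := soft.
have [fin [z Hz]] := @hard_core_deviation _ (lebesgueR R) R
  (@completed_lebesgue_measure R) A gamma (@gaussian_potential R) r0 mA tA gamma01 gr0
  measurable_gaussian (fun x => ltW (gaussian_gt0 x)) integral_gaussian_lty
  (integral_gaussian_gt0 (mA r0) kappa0 kA) c c_gt0.
exists z => eps eps0; have := Hz eps eps0.
set P := (X in X @ _ --> _ -> _); set Q := (X in _ -> X @ _ --> _).
have -> // : Q = P.
apply/funext => N; rewrite /P /Q /graph_prob.
rewrite -sum_ffun_iid_mean big_mkcond/=; apply: eq_bigr => g _.
(* The partition function is a positive real [y], so [lne] agrees with [ln] and the value [-oo]
   never occurs. *)
have [y y0 yE] := fin N [seq g e | e <- enum 'I_(Num.truncn (c * N%:R))].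
rewrite yE/=.
have pf : partition_function (@gaussian_potential R) (block_potential gamma A) g = y%:E.
  rewrite -yE /partition_function /potential_integral.
  by apply: eq_integral => x _; rewrite big_map big_enum.
rewrite (_ : (g \in _) = (eps < `|N%:R^-1 * ln y - z|)); last first.
  by apply/idP/idP; rewrite inE/= pf lne_EFin// -EFinM -EFinB lte_fin.
by case: (_ < _); rewrite ?mulr1 ?mulr0.
Qed.
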